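(* Let $\gamma$ be a fixed variogram on $\mathbb R^d$. For a probability measure $\nu$ on $(0,\infty)$ let $$\rho_{\gamma,\nu}(h)=\int_0^\infty2\left(1-\Phi\left(s\sqrt{\gamma(h)}\right)\right)\nu(ds),\qquad h\in\mathbb R^d .$$ Then the class of functions $\{\rho_{\gamma,\nu}:\nu\text{ a probability measure on }(0,\infty)\}$ coincides with the class of all functions $h\mapsto\varphi(\sqrt{\gamma(h)})$, $h\in\mathbb R^d$, where $\varphi:[0,\infty)\to\mathbb R$ is a continuous function, infinitely differentiable on $(0,\infty)$, with $\varphi(0)=1$ and $\lim_{u\to\infty}\varphi(u)=0$, such that the function $$u\mapsto(-1)^k\frac{d^k}{du^k}\left[-\varphi'(\sqrt u)\right],\qquad u\in(0,\infty),$$ is nonnegative for infinitely many positive integers $k$ (i.e. $u\mapsto-\varphi'(\sqrt u)$ is completely monotone).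
   Context: $\Phi$ is the standard normal distribution function. A variogram on $\mathbb R^d$ is a (symmetric, real-valued) conditionally negative definite function $\gamma:\mathbb R^d\to[0,\infty)$ with $\gamma(0)=0$. The function $\rho_{\gamma,\nu}$ is the extremal correlation function of the max-mixture of Brown–Resnick processes whose mixture measure is the law of $S^2\gamma$ with $S\sim\nu$. A function on $(0,\infty)$ is completely monotone if it is infinitely differentiable and $(-1)^k$ times its $k$-th derivative is nonnegative for all $k\ge0$. *)

(* Defs.v *)
From HB Require Import structures.
From mathcomp Require Import all_boot all_order all_algebra.
From mathcomp Require Import all_classical all_reals all_analysis.

Set Implicit Arguments.
Unset Strict Implicit.
Unset Printing Implicit Defensive.

Import Order.TTheory GRing.Theory Num.Theory.
Import numFieldNormedType.Exports.

Local Open Scope classical_set_scope.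
Local Open Scope ring_scope.

Definition std_normal_cdf (R : realType) (x : R) : R :=
  fine (normal_prob (0 : R) 1 `]-oo, x]).

Definition cond_negative_definite (R : realType) (d : nat)
    (gamma : 'rV[R]_d -> R) : Prop :=
  (forall h, gamma (- h) = gamma h) /\
  (forall (n : nat) (x : 'I_n -> 'rV[R]_d) (a : 'I_n -> R),
    \sum_(i < n) a i = 0 ->
    \sum_(i < n) \sum_(j < n) a i * a j * gamma (x i - x j) <= 0).

Definition variogram (R : realType) (d : nat) (gamma : 'rV[R]_d -> R) : Prop :=
  [/\ cond_negative_definite gamma,
      forall h, 0 <= gamma h
    & gamma 0 = 0].

(* Probability measures on (0, oo) are encoded as Borel probability measures on
   R that give mass 1 to ]0, +oo[. *)
Definition on_pos (R : realType) (nu : probability (measurableTypeR R) R) :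
  Prop := nu `]0%R, +oo[%classic = 1%E.

Definition rho (R : realType) (d : nat) (gamma : 'rV[R]_d -> R)
    (nu : probability (measurableTypeR R) R) (h : 'rV[R]_d) : R :=
  \int[nu]_(s in `]0, +oo[)
    (2 * (1 - std_normal_cdf (s * Num.sqrt (gamma h)))).

(* The iterated derivatives at a point of ]0, +oo[ depend only on the values
   near that point, so the (arbitrary) values of f outside ]0, +oo[ are
   irrelevant; the same holds for complete monotonicity below. *)
Definition smooth_on_pos (R : realType) (f : R -> R) : Prop :=
  forall (k : nat) (t : R), 0 < t -> derivable f^`(k)%classic t 1.

Definition alternating_at (R : realType) (f : R -> R) (k : nat) : Prop :=
  forall u : R, 0 < u -> 0 <= (-1) ^+ k * f^`(k)%classic u.

Definition completely_monotone (R : realType) (f : R -> R) : Prop :=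
  smooth_on_pos f /\ forall k : nat, alternating_at f k.

(* A function on [0, oo) is encoded as a function on R whose values on the
   negative half-line are never used. *)
Definition admissible (R : realType) (phi : R -> R) : Prop :=
  [/\ {within `[0, +oo[, continuous phi},
      smooth_on_pos phi,
      phi 0 = 1
    & phi t @[t --> +oo] --> (0 : R)].

Definition neg_deriv_sqrt (R : realType) (phi : R -> R) (u : R) : R :=
  - phi^`()%classic (Num.sqrt u).

Definition inf_often_alternating (R : realType) (f : R -> R) : Prop :=
  infinite_set [set k : nat | (0 < k)%N /\ alternating_at f k].

(* Main.v *)
(** If f(v) = -phi'(sqrt v) has a k-th derivative of sign (-1)^k, then its
    (k-1)-st derivative has sign (-1)^(k-1): otherwise the latter stays away
    from 0 near infinity with the wrong sign, and integrating down to phi makes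
    phi unbounded.  So infinitely many sign conditions give all of them.

    A mixture phi of the tails T(su), T = 2(1 - Phi), is differentiated under
    the integral: -phi'(sqrt u) is the integral of a multiple of
    s exp(-s^2 u / 2), which is completely monotone.

    For the converse, Bernstein's theorem is replaced by an explicit
    approximation of phi itself.  With beta_0(v) = phi(1/v), put
      beta_{k+1}(v) = beta_k(v) + v beta_k'(v) / (2k+1).
    Then beta_k'(v) is a positive multiple of (-1)^k f^(k)(v^-2) v^-(2k+2), so
    complete monotonicity makes every beta_k a distribution function on
    (0, oo), and inverting the recursion gives
      beta_0(v) = int_0^1 q_k(w) beta_k(vw) dw,  q_k(w) ~ (1 - w^2)^(k-1).
    After rescaling w by sqrt(2k) the kernels converge to the density p of the
    half-normal law; Helly's theorem and Fatou's lemma yield a distribution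
    function H with phi(1/v) = int_0^oo p(r) H(vr) dr, and Tonelli's theorem
    turns this into phi(u) = int T(su) dH(s). *)
From HB Require Import structures.
Require Import Defs.
From mathcomp Require Import all_boot all_order all_algebra.
From mathcomp Require Import all_classical all_reals all_analysis.
From mathcomp Require Import measurable_realfun normal_distribution.
From mathcomp Require Import ring lra.

Set Implicit Arguments.
Unset Strict Implicit.
Unset Printing Implicit Defensive.

Import Order.TTheory GRing.Theory Num.Theory.
Import numFieldNormedType.Exports.

Local Open Scope classical_set_scope.
Local Open Scope ring_scope.

(** * Differentiation on the open half-line *)

Section half_line_calculus.
Context {R : realType}.
Implicit Types f g h : R -> R.

Lemma near_pos (t : R) : 0 < t -> \forall s \near t, 0 < s.
Proof. by move=> t0; exact: lt_nbhsr. Qed.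

Lemma is_derive_eq_pos f g (t l : R) : 0 < t ->
  (forall s : R, 0 < s -> f s = g s) -> is_derive t 1 f l -> is_derive t 1 g l.
Proof.
move=> t0 fg; apply: near_eq_is_derive.
by apply: filterS (near_pos t0) => s; exact: fg.
Qed.

Lemma is_derive1E f (t l : R) : is_derive t 1 f l -> f^`()%classic t = l.
Proof. by move=> fl; rewrite derive1E derive_val. Qed.

Lemma derivable_is_derive1 f (t : R) :
  derivable f t 1 -> is_derive t 1 f (f^`()%classic t).
Proof. by move=> ft; rewrite derive1E; exact: derivableP. Qed.

Lemma is_derive_continuous f (t l : R) : is_derive t 1 f l -> {for t, continuous f}.
Proof. by move=> fl; apply: differentiable_continuous; apply/derivable1_diffP. Qed.

Lemma is_derive1M f g (t l m : R) : is_derive t 1 f l -> is_derive t 1 g m ->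
  is_derive t 1 (fun s => f s * g s) (l * g t + f t * m).
Proof.
move=> fl gm; apply: (is_derive_eq (is_deriveM fl gm)).
by rewrite /GRing.scale /= addrC [g t * l]mulrC.
Qed.

Lemma is_derive1_compM f h (t l m : R) :
  is_derive t 1 h m -> is_derive (h t) 1 f l ->
  is_derive t 1 (fun s => f (h s)) (m * l).
Proof. by move=> hm fl; rewrite mulrC; exact: is_derive1_comp. Qed.

Lemma is_derive_expn n (t : R) :
  is_derive t 1 (fun s => s ^+ n) (n%:R * t ^+ n.-1).
Proof.
apply: DeriveDef; first exact: exprn_derivable.
by rewrite exp_derive /GRing.scale /= mulr1.
Qed.

Lemma is_derive_sqr (t : R) : is_derive t 1 (fun s => s ^+ 2) (2 * t).
Proof. exact: is_derive_expn. Qed.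

Lemma mvt_pos f (df : R -> R) (a b : R) :
  (forall t : R, 0 < t -> is_derive t 1 f (df t)) ->
  0 < a -> a <= b -> exists2 c, a <= c <= b & f b - f a = df c * (b - a).
Proof.
move=> fdf a0 ab.
have [||c] := @MVT_segment R f df a b ab.
- by move=> x; rewrite in_itv/= => /andP[ax _]; exact/fdf/(lt_trans a0).
- apply: continuous_in_subspaceT => x; rewrite inE/= in_itv/= => /andP[ax _].
  exact/is_derive_continuous/fdf/(lt_le_trans a0).
by rewrite in_itv/=; exists c.
Qed.

Lemma homo_pos f (df : R -> R) :
  (forall t : R, 0 < t -> is_derive t 1 f (df t)) ->
  (forall t : R, 0 < t -> 0 <= df t) -> forall a b : R, 0 < a -> a <= b -> f a <= f b.
Proof.
move=> fdf df0 a b a0 ab; have [c /andP[ac _] e] := mvt_pos fdf a0 ab.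
by rewrite -subr_ge0 e mulr_ge0 ?subr_ge0// df0// (lt_le_trans a0).
Qed.

(** Recording successive derivative functions on the half-line lets sums, products and compositions
    be treated by induction, without formulas for iterated derivatives. *)
Fixpoint Cpos (n : nat) f : Prop :=
  if n is m.+1 then
    exists2 df : R -> R, (forall t : R, 0 < t -> is_derive t 1 f (df t)) & Cpos m df
  else True.

Lemma Cpos_eq n f g : (forall s : R, 0 < s -> f s = g s) -> Cpos n f -> Cpos n g.
Proof.
case: n => // n fg [df fdf Cdf]; exists df => // t t0.
exact: (is_derive_eq_pos t0 fg (fdf _ t0)).
Qed.

Lemma CposW n f : Cpos n.+1 f -> Cpos n f.
Proof. by elim: n f => // n IH f [df fdf /IH Cdf]; exists df. Qed.

Lemma smooth_on_posP f : smooth_on_pos f <-> forall n, Cpos n f.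
Proof.
split=> [+ n|].
  elim: n f => // n IH f sf; exists f^`()%classic => [t t0|].
    exact: derivable_is_derive1 (sf 0%N t t0).
  by apply: IH => k t t0; rewrite -derive1Sn; exact: sf.
move=> + k; elim: k f => [f Cf t t0|k IH f Cf t t0].
  have [df fdf _] := Cf 1%N.
  by rewrite derive1n0; case: (fdf t t0).
rewrite derive1Sn; apply: IH => // n.
have [df fdf Cdf] := Cf n.+1.
by apply: Cpos_eq Cdf => s s0; rewrite (is_derive1E (fdf s s0)).
Qed.

Lemma CposD n f g : Cpos n f -> Cpos n g -> Cpos n (fun t => f t + g t).
Proof.
elim: n f g => // n IH f g [df fdf Cf] [dg gdg Cg].
exists (fun t => df t + dg t) => [t t0|]; last exact: IH.
by apply: is_deriveD; [exact: fdf|exact: gdg].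
Qed.

Lemma CposM n f g : Cpos n f -> Cpos n g -> Cpos n (fun t => f t * g t).
Proof.
elim: n f g => // n IH f g Cf Cg.
(* The product rule also involves [f] and [g] themselves, at order [n]. *)
have Cf' := CposW Cf; have Cg' := CposW Cg.
move: Cf Cg => [df fdf Cdf] [dg gdg Cdg].
exists (fun t => df t * g t + f t * dg t) => [t t0|].
  by apply: is_derive1M; [exact: fdf|exact: gdg].
by apply: CposD; apply: IH.
Qed.

Lemma Cpos_cst n (c : R) : Cpos n (fun=> c).
Proof.
elim: n c => // n IH c; exists (fun=> 0) => // t _; exact: is_derive_cst.
Qed.

Lemma CposN n f : Cpos n f -> Cpos n (fun t => - f t).
Proof.
move=> Cf; apply: (@Cpos_eq n (fun t => -1 * f t)); last first.
  by apply: CposM => //; exact: Cpos_cst.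
by move=> s _; rewrite mulN1r.
Qed.

Lemma Cpos_comp n f h : (forall t : R, 0 < t -> 0 < h t) ->
  Cpos n f -> Cpos n h -> Cpos n (fun t => f (h t)).
Proof.
move=> h0; elim: n f => // n IH f [df fdf Cdf] Ch.
have Ch' := CposW Ch; move: Ch => [dh hdh Cdh].
exists (fun t => dh t * df (h t)) => [t t0|].
  by apply: is_derive1_compM; [exact: hdh|exact/fdf/h0].
by apply: CposM => //; exact: IH.
Qed.

Lemma Cpos_id n : Cpos n (fun t : R => t).
Proof.
case: n => // n; exists (fun=> 1); last exact: Cpos_cst.
by move=> t _; exact: is_derive_id.
Qed.

Lemma Cpos_inv n : Cpos n (fun t : R => t^-1).
Proof.
elim: n => // n IH; exists (fun t => - (t^-1 * t^-1)).
  move=> t t0; apply: is_derive_eq; first by apply: is_deriveV; rewrite gt_eqF.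
  by rewrite /GRing.scale /= mulr1 expr2 invfM.
by apply: CposN; exact: CposM.
Qed.

Lemma Cpos_sqrt n : Cpos n (@Num.sqrt R).
Proof.
elim: n => // n IH; exists (fun t => (2 * Num.sqrt t)^-1).
  by move=> t t0; exact: is_derive1_sqrt.
apply: (@Cpos_eq n (fun t => 2^-1 * (Num.sqrt t)^-1)).
  by move=> s _; rewrite invfM.
apply: CposM; first exact: Cpos_cst.
by apply: (Cpos_comp _ (Cpos_inv n) IH) => t; rewrite sqrtr_gt0.
Qed.

Lemma Cpos_neg_deriv_sqrt n f : Cpos n.+1 f -> Cpos n (neg_deriv_sqrt f).
Proof.
move=> [df fdf Cdf]; apply: CposN.
apply: (@Cpos_eq n (fun u => df (Num.sqrt u))).
  by move=> s s0; rewrite (is_derive1E (fdf _ _))// sqrtr_gt0.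
by apply: Cpos_comp Cdf (Cpos_sqrt n) => t; rewrite sqrtr_gt0.
Qed.

End half_line_calculus.

(** * From infinitely many sign conditions to complete monotonicity *)

Section alternating.
Context {R : realType}.
Implicit Types f phi : R -> R.

Lemma smooth_neg_deriv_sqrt phi :
  smooth_on_pos phi -> smooth_on_pos (neg_deriv_sqrt phi).
Proof.
move/smooth_on_posP => sphi; apply/smooth_on_posP => n.
exact: Cpos_neg_deriv_sqrt.
Qed.

Lemma is_derive_iter f (k : nat) (t : R) : smooth_on_pos f -> 0 < t ->
  is_derive t 1 f^`(k)%classic (f^`(k.+1)%classic t).
Proof. by move=> sf t0; rewrite derive1nS; exact/derivable_is_derive1/sf. Qed.

Lemma is_derive_phi phi (x : R) : smooth_on_pos phi -> 0 < x ->
  is_derive x 1 phi (- neg_deriv_sqrt phi (x ^+ 2)).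
Proof.
move=> sphi x0; rewrite /neg_deriv_sqrt opprK sqrtr_sqr gtr0_norm//.
exact/derivable_is_derive1/(sphi 0%N).
Qed.

(** This form is stable under taking primitives; the threshold is kept positive so that the mean
    value theorem on the half-line applies from it. *)
Definition eventually_neg f := exists2 c : R, 0 < c &
  exists2 a : R, 0 < a & forall u, a <= u -> f u <= - c.

Lemma eventually_neg_primitive f (df : R -> R) :
  (forall t : R, 0 < t -> is_derive t 1 f (df t)) ->
  eventually_neg df -> eventually_neg f.
Proof.
move=> fdf [c c0 [a a0 H]].
(* Beyond this point the drop c (u - a) is at least |f a| + 1, so f u <= -1. *)
exists 1 => //; exists (a + (`|f a| + 1) / c).
  by rewrite ltr_wpDr// divr_ge0 ?addr_ge0// ltW.
move=> u au; have au' : a <= u.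
  by rewrite (le_trans _ au)// lerDl divr_ge0 ?addr_ge0// ltW.
have [b /andP[ab bu] e] := mvt_pos fdf a0 au'.
rewrite -[f u](subrK (f a)) e.
have h1 : df b * (u - a) <= - c * (u - a).
  by rewrite ler_wpM2r ?subr_ge0// H.
have h2 : `|f a| + 1 <= c * (u - a).
  by rewrite mulrC -ler_pdivrMr// lerBrDl.
have := ler_norm (f a); lra.
Qed.

Lemma alternating_at_pred phi k : smooth_on_pos phi ->
  phi t @[t --> +oo] --> (0 : R) ->
  alternating_at (neg_deriv_sqrt phi) k.+1 ->
  alternating_at (neg_deriv_sqrt phi) k.
Proof.
move=> sphi phi0 alt u u0; rewrite leNgt; apply/negP => neg.
set g := neg_deriv_sqrt phi in alt neg; set e : R := (-1) ^+ k in neg.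
have sg : smooth_on_pos g by exact: smooth_neg_deriv_sqrt.
have dg j (t : R) : 0 < t ->
    is_derive t 1 (fun s => e * g^`(j)%classic s) (e * g^`(j.+1)%classic t).
  by move=> t0; exact/is_deriveZ/is_derive_iter.
(* The sign condition of order [k.+1] makes this function nonincreasing, so its negative value at
   [u] bounds it from [u] on. *)
have : eventually_neg (fun s => e * g^`(k)%classic s).
  exists (- (e * g^`(k)%classic u)); first by rewrite oppr_gt0.
  exists u => // v uv; rewrite opprK -lerN2.
  apply: (@homo_pos _ (fun s => - (e * g^`(k)%classic s))
    (fun s => - (e * g^`(k.+1)%classic s))) uv => // t t0.
    exact/is_deriveN/dg.
  by have := alt t t0; rewrite exprS mulN1r mulNr.
have down j : eventually_neg (fun s => e * g^`(j)%classic s) ->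
    eventually_neg (fun s => e * g s).
  elim: j => // j IH /(eventually_neg_primitive (dg j)); exact: IH.
move/down => [c c0 [a a0 H]].
(* The last integration, from [g] to [phi], takes place in the variable x with u = x^2. *)
have dphi (x : R) : 0 < x -> is_derive x 1 (fun x => - e * phi x) (e * g (x ^+ 2)).
  move=> x0; apply: (is_derive_eq (is_deriveZ (- e) (is_derive_phi sphi x0))).
  by rewrite /GRing.scale /= mulrNN.
have low : eventually_neg (fun x => e * g (x ^+ 2)).
  exists c => //; exists (a + 1) => [|x ax]; first by rewrite addr_gt0.
  by apply: H; nra.
have [b b0 [a' a'0 H']] := eventually_neg_primitive dphi low.
move/cvgrPdist_lt : phi0 => /(_ _ b0) [M [_ HM]].
(* Beyond both thresholds |phi| is at least [b] and also less than [b]. *)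
pose x := Num.max a' (M + 1).
have := HM x; rewrite /x lt_max ltrDl ltr01 orbT sub0r normrN => /(_ isT).
have := H' x; rewrite /x le_max lexx => /(_ isT).
rewrite mulNr lerN2 => hb hn.
have : b <= `|phi (Num.max a' (M + 1))|.
  apply: (le_trans hb); rewrite (le_trans (ler_norm _))//.
  by rewrite normrM /e normrX normrN1 expr1n mul1r.
by rewrite leNgt hn.
Qed.

Lemma inf_often_alternatingP phi : admissible phi ->
  inf_often_alternating (neg_deriv_sqrt phi) <->
  completely_monotone (neg_deriv_sqrt phi).
Proof.
move=> [_ sphi _ phi0]; split=> [inf|[_ alt]].
  split=> [|k]; first exact: smooth_neg_deriv_sqrt.
  (* If all good indices were below [k], there would be only finitely many. *)
  have [m [_ altm] km] : exists2 m,
      (0 < m)%N /\ alternating_at (neg_deriv_sqrt phi) m & (k <= m)%N.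
    apply: contrapT => /forall2NP noinf; apply: inf.
    apply: (@sub_finite_set _ _ `I_k); last exact: finite_II.
    move=> m /= Hm; rewrite ltnNge; apply/negP => km.
    by have [|] := noinf m.
  move: altm; rewrite -(subnKC km); elim: (m - k)%N => [|j IH].
    by rewrite addn0.
  by rewrite addnS => /(alternating_at_pred sphi phi0).
apply: sub_infinite_set (infinite_setD infinite_nat (finite_II 1)) => m [_ /= m1].
by split=> //; rewrite lt0n; apply/eqP => m0; apply: m1; rewrite m0.
Qed.

End alternating.

(** * The half-normal law *)

Section half_normal.
Context {R : realType}.
Notation mu := (@lebesgue_measure R).

Definition half_normal_pdf (x : R) : R := 2 * normal_pdf 0 1 x.

Definition half_normal_tail (x : R) : R := 2 * (1 - std_normal_cdf x).

Lemma half_normal_pdfE x :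
  half_normal_pdf x = 2 * normal_peak 1 * expR (- (x ^+ 2 / 2)).
Proof.
rewrite /half_normal_pdf /normal_pdf (negbTE (oner_neq0 _)) mulrA.
by rewrite /normal_fun subr0 expr1n mulNr.
Qed.

Lemma half_normal_pdf_ge0 x : 0 <= half_normal_pdf x.
Proof. by rewrite mulr_ge0// normal_pdf_ge0. Qed.

Lemma measurable_half_normal_pdf : measurable_fun [set: R] half_normal_pdf.
Proof. by apply: measurable_funM => //; exact: measurable_normal_pdf. Qed.

Lemma half_normal_tailE x :
  (half_normal_tail x)%:E = (\int[mu]_(r in `[x, +oo[) (half_normal_pdf r)%:E)%E.
Proof.
rewrite /half_normal_tail /std_normal_cdf EFinM EFinB fineK ?fin_num_measure//.
have -> : (1%:E - normal_prob 0 1 `]-oo, x] = normal_prob 0 1 `]x, +oo[)%E.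
  by rewrite -[`]x, +oo[%classic]setCitvl probability_setC.
rewrite /normal_prob -(@integral_itv_obnd_cbnd _ x +oo%O).
  rewrite -ge0_integralZl//=.
  - by apply/measurable_funTS/measurable_EFinP; exact: measurable_normal_pdf.
  - by move=> r _; rewrite lee_fin normal_pdf_ge0.
by apply/measurable_funTS/measurable_EFinP; exact: measurable_half_normal_pdf.
Qed.

Lemma half_normal_tail_ge0 x : 0 <= half_normal_tail x.
Proof.
rewrite -lee_fin half_normal_tailE; apply: integral_ge0 => r _.
by rewrite lee_fin half_normal_pdf_ge0.
Qed.

(** The tail exceeds 1 at negative arguments; the bound 2 holds on the whole line and gives mixtures
    a constant majorant at every real argument. *)
Lemma half_normal_tail_le2 x : half_normal_tail x <= 2.
Proof.
rewrite /half_normal_tail ler_piMr// lerBlDr lerDl.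
by rewrite /std_normal_cdf fine_ge0.
Qed.

(** The normal density is even with total mass 1, so the half-line carries 1/2. *)
Lemma half_normal_tail0 : half_normal_tail 0 = 1.
Proof.
apply: EFin_inj; rewrite half_normal_tailE /half_normal_pdf.
under eq_integral do rewrite EFinM.
rewrite ge0_integralZl//=.
- rewrite -(@integral_normal_pdf R 0 1) ge0_symfun_integralT//.
  + by congr (_ * integral _ _ _)%E; apply/seteqP; split=> x/=; rewrite in_itv/= andbT.
  + by move=> x; exact: normal_pdf_ge0.
  + by apply: continuous_normal_pdf; rewrite oner_neq0.
  + move=> x; rewrite /normal_pdf /= (negbTE (oner_neq0 _)) /normal_fun.
    by rewrite !subr0 sqrrN.
- by apply/measurable_funTS/measurable_EFinP; exact: measurable_normal_pdf.
- by move=> r _; rewrite lee_fin normal_pdf_ge0.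
Qed.

Lemma is_derive_half_normal_tail (x : R) :
  is_derive x 1 half_normal_tail (- half_normal_pdf x).
Proof.
have cpdf : {for x, continuous (@normal_pdf R 0 1)}.
  by apply: continuous_normal_pdf; rewrite oner_neq0.
have ipdf : mu.-integrable `]-oo, x + 1] (EFin \o normal_pdf 0 1).
  exact: (integrableS _ _ (@subsetT _ _) (integrable_normal_pdf 0 1)).
have x1 : x < x + 1 by rewrite ltrDl.
have [dF F'] := continuous_FTC1 x1 ipdf (ltNyr _) cpdf.
have H : is_derive x 1 (@std_normal_cdf R) (normal_pdf 0 1 x).
  by rewrite -F'; exact: derivable_is_derive1.
have := is_deriveZ 2 (is_deriveB (is_derive_cst (1 : R) x 1) H).
by rewrite /GRing.scale /= sub0r mulrN.
Qed.

Lemma continuous_half_normal_tail : continuous half_normal_tail.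
Proof. by move=> x; exact/is_derive_continuous/is_derive_half_normal_tail. Qed.

(** The identity seen as a random variable under the normal law, so that [cvg_cdfy1] gives the limit
    of [std_normal_cdf] at infinity. *)
Let idR : measurableTypeR R -> R := idfun.

#[local] HB.instance Definition _ :=
  @isMeasurableFun.Build _ _ _ _ idR (@measurable_id _ _ setT).

Lemma cvg_half_normal_tail : half_normal_tail x @[x --> +oo] --> (0 : R).
Proof.
have cdf1 : @std_normal_cdf R x @[x --> +oo] --> (1 : R).
  exact: fine_cvg (cvg_cdfy1 (idR : {RV normal_prob (0 : R) 1 >-> R})).
rewrite -[0 : R](mulr0 2) -[X in 2 * X](subrr 1).
by apply: cvgMl_tmp; apply: cvgB => //; exact: cvg_cst.
Qed.

End half_normal.

(** * Mixtures of half-normal tails are admissible *)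

Section gauss_mixture.
Context {R : realType}.

Lemma expR_poly_bounded (a : R) (n : nat) : 0 < a ->
  (* The constant chosen below comes from e^z >= z^(n+1) / (n+1)! at z = a (1 + y). *)
  exists2 C : R, 0 <= C & forall y, 0 <= y -> (1 + y) ^+ n.+1 * expR (- (y * a)) <= C.
Proof.
move=> a0; exists (n.+1`!%:R / a ^+ n.+1 * expR a) => [|y y0].
  by rewrite mulr_ge0 ?expR_ge0// divr_ge0// exprn_ge0// ltW.
rewrite expRN ler_pdivrMr ?expR_gt0// -[leRHS]mulrA -expRD.
have an0 : 0 < a ^+ n.+1 by rewrite exprn_gt0.
have fn0 : 0 < n.+1`!%:R :> R by rewrite ltr0n fact_gt0.
have := @expR_ge1Dxn R (a * (1 + y)) n; rewrite mulr_ge0 ?addr_ge0 ?(ltW a0)//.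
move=> /(_ isT) H; rewrite mulrAC ler_pdivlMr// mulrC.
rewrite -ler_pdivrMl// mulrC -exprMn.
have -> : a + y * a = a * (1 + y) by ring.
by apply: le_trans H; rewrite [X in X <= _]mulrC [(1 + y) * a]mulrC lerDr.
Qed.

(* The k-th derivative in u of half_normal_pdf (sqrt u * s) * s. *)
Definition gauss_deriv (k : nat) (u s : R) : R :=
  2 * normal_peak 1 * s * (- (s ^+ 2 / 2)) ^+ k * expR (- (s ^+ 2 / 2 * u)).

(** Up to sign, the left side is the derivative in u of the tail at s u. It depends on u only
    through u^2, so the substitution sqrt u turns it into an exponential in u. *)
Lemma half_normal_pdfM (u s : R) :
  half_normal_pdf (u * s) * s = gauss_deriv 0 (u ^+ 2) s.
Proof.
rewrite half_normal_pdfE /gauss_deriv expr0 mulr1 mulrAC; congr (_ * expR _).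
by rewrite exprMn; ring.
Qed.

Lemma is_derive_gauss_deriv k (u s : R) :
  is_derive u 1 (gauss_deriv k ^~ s) (gauss_deriv k.+1 u s).
Proof.
have He : is_derive u 1 (fun u => - (s ^+ 2 / 2 * u)) (- (s ^+ 2 / 2)).
  apply: (is_derive_eq (is_deriveN (is_deriveZ (s ^+ 2 / 2) (is_derive_id u 1)))).
  by rewrite /GRing.scale /= mulr1.
apply: (is_derive_eq (is_deriveZ (2 * normal_peak 1 * s * (- (s ^+ 2 / 2)) ^+ k)
  (is_derive1_compM He (is_derive_expR _)))).
by rewrite /GRing.scale /= /gauss_deriv [_ ^+ k.+1]exprSr !mulrA.
Qed.

(** With y = s^2 / 2, both s and y are at most 1 + y, so the absolute value is at most a constant
    times (1 + y)^(k+1) e^(-ya). *)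
Lemma gauss_deriv_bounded k (a : R) : 0 < a -> exists2 C : R, 0 <= C &
  forall u s, a <= u -> 0 < s -> `|gauss_deriv k u s| <= C.
Proof.
move=> a0; have [C C0 HC] := expR_poly_bounded k a0.
exists (2 * normal_peak 1 * C) => [|u s au s0].
  by rewrite !mulr_ge0// normal_peak_ge0.
have y0 : 0 <= s ^+ 2 / 2 by rewrite divr_ge0// sqr_ge0.
have sy : s <= 1 + s ^+ 2 / 2 by have := sqr_ge0 (s - 1); lra.
rewrite /gauss_deriv; move: (s ^+ 2 / 2) y0 sy => y y0 sy.
rewrite !normrM normrX normrN (ger0_norm y0) (ger0_norm (ltW s0)).
rewrite (ger0_norm (expR_ge0 _)) (ger0_norm (normal_peak_ge0 _)) ger0_norm//.
rewrite -!mulrA !ler_wpM2l ?normal_peak_ge0//.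
apply: le_trans (HC _ y0); rewrite [X in _ <= X * _]exprS -[leRHS]mulrA.
apply: ler_pM => //; first exact: ltW.
  by rewrite mulr_ge0 ?exprn_ge0 ?expR_ge0.
apply: ler_pM; rewrite ?exprn_ge0 ?expR_ge0//.
  by rewrite lerXn2r ?nnegrE ?addr_ge0// lerDr.
by rewrite ler_expR lerN2 ler_wpM2l.
Qed.

Lemma measurable_gauss_deriv k (u : R) : measurable_fun [set: R] (gauss_deriv k u).
Proof.
have mq : measurable_fun [set: R] (fun s : R => s ^+ 2 / 2).
  by apply: measurable_funM => //; exact: measurable_funX.
apply: measurable_funM; last first.
  apply: measurableT_comp => //; apply: measurableT_comp => //.
  exact: measurable_funM.
apply: measurable_funM; last by apply: measurable_funX; exact: measurableT_comp.
exact: measurable_funM.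
Qed.

Lemma gauss_deriv_sign k (u s : R) : 0 < s -> 0 <= (-1) ^+ k * gauss_deriv k u s.
Proof.
move=> s0; rewrite /gauss_deriv.
have -> : (-1) ^+ k * (2 * normal_peak 1 * s * (- (s ^+ 2 / 2)) ^+ k *
    expR (- (s ^+ 2 / 2 * u))) =
  2 * normal_peak 1 * s * (-1 * - (s ^+ 2 / 2)) ^+ k * expR (- (s ^+ 2 / 2 * u)).
  by rewrite exprMn; ring.
by rewrite mulN1r opprK !mulr_ge0 ?exprn_ge0 ?expR_ge0 ?normal_peak_ge0
  ?divr_ge0 ?sqr_ge0 ?ltW.
Qed.

Lemma Cpos_family (F : nat -> R -> R) :
  (forall k (t : R), 0 < t -> is_derive t 1 (F k) (F k.+1 t)) ->
  forall n k, Cpos n (F k).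
Proof. by move=> dF; elim=> // n IH k; exists (F k.+1) => // t; exact: dF. Qed.

Lemma iter_derive_family f (F : nat -> R -> R) :
  (forall k (t : R), 0 < t -> is_derive t 1 (F k) (F k.+1 t)) ->
  (forall t, 0 < t -> f t = F 0%N t) ->
  forall k t, 0 < t -> f^`(k)%classic t = F k t.
Proof.
move=> dF fF; elim=> // k IH t t0; rewrite derive1nS; apply: is_derive1E.
by apply: (is_derive_eq_pos t0 _ (dF k t t0)) => s s0; rewrite IH.
Qed.

End gauss_mixture.

(** * Differentiation under the mixture integral *)

Section mixture.
Context {R : realType} (nu : probability (measurableTypeR R) R).
Hypothesis nu_pos : on_pos nu.
Let B : set (measurableTypeR R) := `]0, +oo[%classic.

Let mB : measurable B. Proof. exact: measurable_itv. Qed.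

Let Bs s : B s -> 0 < s. Proof. by rewrite /B /= in_itv/= andbT. Qed.

Let bounded_integrable (f : R -> R) (C : R) : measurable_fun [set: R] f ->
  (forall s, 0 < s -> `|f s| <= C) -> nu.-integrable B (EFin \o f).
Proof.
move=> mf fC; apply: measurable_bounded_integrable => //.
- exact: (le_lt_trans (probability_le1 nu mB) (ltry 1)).
- exact: measurable_funTS.
- exists C; split; first exact: num_real.
  move=> M CM s /Bs s0; exact: le_trans (fC _ s0) (ltW CM).
Qed.

Definition mixture (u : R) : R := \int[nu]_(s in B) half_normal_tail (s * u).

Definition mixture_deriv (k : nat) (u : R) : R :=
  \int[nu]_(s in B) gauss_deriv k u s.

(** Since [nu] is finite, a constant bound on the derivative near [u] is an integrable majorant. *)
Let is_derive_under (f df : R -> R -> R) (u a b : R) (C : R) :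
  a < u < b ->
  (forall x, x \in `]a, b[ -> nu.-integrable B (EFin \o f x)) ->
  (forall x s, x \in `]a, b[ -> 0 < s -> is_derive x 1 (f ^~ s) (df x s)) ->
  0 <= C -> (forall x s, x \in `]a, b[ -> 0 < s -> `|df x s| <= C) ->
  is_derive u 1 (fun x => \int[nu]_(s in B) f x s) (\int[nu]_(s in B) df u s).
Proof.
move=> uab fi fdf C0 dfC.
have Iu : `]a, b[%classic u by rewrite /= in_itv.
have h1 x s : `]a, b[%classic x -> B s -> derivable (f ^~ s) x 1.
  by move=> xI /Bs s0; case: (fdf x s xI s0).
have iC : nu.-integrable B (EFin \o cst C).
  by apply: (@bounded_integrable _ C) => // s _; rewrite ger0_norm.
have h2 x s : `]a, b[%classic x -> B s -> `|partial1of2 f x s| <= cst C s.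
  by move=> xI /Bs s0; rewrite /partial1of2 (is_derive1E (fdf x s xI s0)) dfC.
have D := derivable_under_integral mB Iu fi h1 (fun=> C0) iC h2.
have -> : \int[nu]_(s in B) df u s = (fun x => \int[nu]_(s in B) f x s)^`()%classic u.
  rewrite (differentiation_under_integral mB Iu fi h1 (fun=> C0) iC h2).
  apply: eq_Rintegral => s /set_mem/Bs s0.
  by rewrite /partial1of2 (is_derive1E (fdf u s _ s0)).
exact: derivable_is_derive1.
Qed.

Lemma is_derive_mixture_deriv k (u : R) : 0 < u ->
  is_derive u 1 (mixture_deriv k) (mixture_deriv k.+1 u).
Proof.
move=> u0; have u20 : 0 < u / 2 by rewrite divr_gt0.
have [C C0 HC] := gauss_deriv_bounded k u20.
have [C' C'0 HC'] := gauss_deriv_bounded k.+1 u20.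
(* The interval from u/2 to 2u stays away from 0, as [gauss_deriv_bounded] requires. *)
apply: (@is_derive_under _ _ u (u / 2) (2 * u) C') => //.
- by rewrite ltr_pdivrMr// ltr_pMr ?ltr1n// ltr_pMl ?ltr1n.
- move=> x; rewrite in_itv/= => /andP[ux _].
  apply: (@bounded_integrable _ C); first exact: measurable_gauss_deriv.
  by move=> s s0; rewrite HC// ltW.
- by move=> x s _ _; exact: is_derive_gauss_deriv.
- by move=> x s; rewrite in_itv/= => /andP[ux _] s0; rewrite HC'// ltW.
Qed.

Let measurable_tail (u : R) : measurable_fun [set: R] (fun s => half_normal_tail (s * u)).
Proof.
have mt := continuous_measurable_fun (@continuous_half_normal_tail R).
by apply: (measurableT_comp mt); exact: measurable_funM.
Qed.

Let tail_norm_le2 (u : R) : `|half_normal_tail u| <= 2.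
Proof. by rewrite ger0_norm ?half_normal_tail_ge0// half_normal_tail_le2. Qed.

Lemma mixture_integrable (u : R) :
  nu.-integrable B (EFin \o fun s => half_normal_tail (s * u)).
Proof. exact: (@bounded_integrable _ 2). Qed.

Lemma is_derive_mixture (x : R) : 0 < x ->
  is_derive x 1 mixture (- mixture_deriv 0 (x ^+ 2)).
Proof.
move=> x0; have x20 : 0 < (x / 2) ^+ 2 by rewrite exprn_gt0 ?divr_gt0.
have [C C0 HC] := gauss_deriv_bounded 0 x20.
have HI y : 0 < y -> nu.-integrable B (EFin \o gauss_deriv 0 (y ^+ 2)).
  move=> y0; have y20 : 0 < y ^+ 2 by rewrite exprn_gt0.
  have [C' _ HC'] := gauss_deriv_bounded 0 y20.
  apply: (@bounded_integrable _ C'); first exact: measurable_gauss_deriv.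
  by move=> s s0; exact: HC'.
have -> : - mixture_deriv 0 (x ^+ 2) = \int[nu]_(s in B) (- gauss_deriv 0 (x ^+ 2) s).
  rewrite -mulN1r /mixture_deriv -RintegralZl//; last exact: HI.
  by apply: eq_Rintegral => s _; rewrite mulN1r.
apply: (@is_derive_under (fun u s => half_normal_tail (s * u))
  (fun u s => - gauss_deriv 0 (u ^+ 2) s) x (x / 2) (2 * x) C) => //.
- by rewrite ltr_pdivrMr// ltr_pMr ?ltr1n// ltr_pMl ?ltr1n.
- by move=> y _; exact: mixture_integrable.
- move=> y s _ s0; rewrite -half_normal_pdfM -mulNr mulrC.
  have Hs : is_derive y 1 (fun y => s * y) s.
    apply: (is_derive_eq (is_deriveZ s (is_derive_id y 1))).
    by rewrite /GRing.scale /= mulr1.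
  rewrite [y * s]mulrC.
  exact: is_derive1_compM Hs (is_derive_half_normal_tail _).
- move=> y s; rewrite in_itv/= => /andP[xy _] s0; rewrite normrN HC//.
  have hx0 : 0 < x / 2 by rewrite divr_gt0.
  by rewrite lerXn2r ?nnegrE ?(ltW hx0) ?(ltW (lt_trans hx0 xy)) ?(ltW xy).
Qed.

Lemma neg_deriv_sqrt_mixture (u : R) : 0 < u ->
  neg_deriv_sqrt mixture u = mixture_deriv 0 u.
Proof.
move=> u0; rewrite /neg_deriv_sqrt (is_derive1E (is_derive_mixture _)) ?sqrtr_gt0//.
by rewrite opprK sqr_sqrtr// ltW.
Qed.

Lemma smooth_mixture : smooth_on_pos mixture.
Proof.
apply/smooth_on_posP => -[//|n].
exists (fun x => - mixture_deriv 0 (x ^+ 2)); first exact: is_derive_mixture.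
apply: CposN; apply: (@Cpos_comp _ _ (mixture_deriv 0) (fun x => x ^+ 2)).
- by move=> t t0; rewrite exprn_gt0.
- exact: (Cpos_family is_derive_mixture_deriv).
- apply: (@Cpos_eq _ _ (fun t : R => t * t)); first by move=> s; rewrite expr2.
  by apply: CposM; exact: Cpos_id.
Qed.

Lemma alternating_mixture k : alternating_at (neg_deriv_sqrt mixture) k.
Proof.
move=> u u0.
rewrite (iter_derive_family is_derive_mixture_deriv neg_deriv_sqrt_mixture)//.
have [C _ HC] := gauss_deriv_bounded k u0.
rewrite /mixture_deriv -RintegralZl//; last first.
  apply: (@bounded_integrable _ C); first exact: measurable_gauss_deriv.
  by move=> s s0; exact: HC.
by apply: Rintegral_ge0 => s /Bs; exact: gauss_deriv_sign.
Qed.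

Lemma mixture0 : mixture 0 = 1.
Proof.
rewrite /mixture; under eq_Rintegral do rewrite mulr0 half_normal_tail0.
by rewrite Rintegral_cst// mul1r; exact: (congr1 fine nu_pos).
Qed.

Lemma continuous_mixture : continuous mixture.
Proof.
move=> x.
have iC : nu.-integrable B (EFin \o cst (2 : R)).
  by apply: (@bounded_integrable _ 2) => // s _; rewrite ger0_norm.
have := @continuity_under_integral R _ _ nu (fun u s => half_normal_tail (s * u))
  B mB (x - 1) (x + 1) _ _ _ iC.
apply.
- by move=> y _; exact: mixture_integrable.
- apply: aeW => s _ y _.
  apply: (@continuous_comp R R R ( *%R s) half_normal_tail).
    exact: mulrl_continuous.
  exact: continuous_half_normal_tail.
- by move=> y _; apply: aeW => s _; exact: tail_norm_le2.
- by rewrite inE/= in_itv/= ltrBlDr !ltrDl ltr01.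
Qed.

Lemma cvg_mixture : mixture u @[u --> +oo] --> (0 : R).
Proof.
(* Dominated convergence concerns sequences, so the limit is tested along an arbitrary one tending
   to infinity; s > 0 makes s w_n tend to infinity too. *)
apply/cvg_pinftyP => w wy.
have iC : nu.-integrable B (EFin \o cst (2 : R)).
  by apply: (@bounded_integrable _ 2) => // s _; rewrite ger0_norm.
have [||||_ _ H] := @dominated_convergence _ _ R nu B mB
  (fun n s => (half_normal_tail (s * w n))%:E) (cst 0%E) (EFin \o cst 2) _ _ _ iC _.
- by move=> n; apply/measurable_funTS/measurable_EFinP; exact: measurable_tail.
- exact: measurable_cst.
- apply: aeW => s /Bs s0; apply: cvg_EFin; first exact: nearW.
  have sw : s * w n @[n --> \oo] --> +oo.
    have sy : s * x @[x --> +oo] --> +oo by exact: (gt0_cvgMry s0 cvg_id).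
    exact: (cvg_comp w ( *%R s) wy sy).
  exact: (cvg_comp (fun n => s * w n) half_normal_tail sw (@cvg_half_normal_tail R)).
- by apply: aeW => s n _; rewrite lee_fin tail_norm_le2.
by rewrite integral0 in H; exact: fine_cvg H.
Qed.

Lemma admissible_mixture : admissible mixture.
Proof.
split.
- by apply: continuous_subspaceT; exact: continuous_mixture.
- exact: smooth_mixture.
- exact: mixture0.
- exact: cvg_mixture.
Qed.

End mixture.

(** * The approximating distribution functions *)

Section bernstein_sequence.
Context {R : realType} (beta d : nat -> R -> R).
Hypothesis dbeta : forall k (v : R), 0 < v -> is_derive v 1 (beta k) (d k v).
Hypothesis d_ge0 : forall k (v : R), 0 < v -> 0 <= d k v.
Hypothesis betaS : forall k (v : R), 0 < v ->
  beta k.+1 v = beta k v + v * d k v / k.*2.+1%:R.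
Hypothesis beta_neg : forall k (v : R), v <= 0 -> beta k v = 0.
Hypothesis beta0_cvg0 : beta 0 v @[v --> 0^'+] --> (0 : R).
Hypothesis beta0_cvg1 : beta 0 v @[v --> +oo] --> (1 : R).

Let beta_homo_pos k (v w : R) : 0 < v -> v <= w -> beta k v <= beta k w.
Proof. exact: homo_pos (dbeta k) (d_ge0 k) v w. Qed.

(* By the mean value theorem, v * d k c = beta k (2 * v) - beta k v for some c
   between v and 2 * v. *)
Lemma beta_le_double k (v : R) : 0 < v ->
  beta k.+1 v <= beta k (2 * v) + 2 * (beta k (2 * v) - beta k v).
Proof.
move=> v0; have v2 : v <= 2 * v by rewrite ler_pMl// ler1n.
have [c /andP[vc cv] e] := mvt_pos (dbeta k) v0 v2.
have c0 := lt_le_trans v0 vc; have dc := d_ge0 k c0.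
apply: (le_trans (beta_homo_pos _ v0 vc)); rewrite betaS//.
apply: lerD; first exact: beta_homo_pos.
rewrite e -mulrA; have -> : 2 * (d k c * (2 * v - v)) = (2 * v) * d k c by ring.
rewrite mulrA; apply: (@le_trans _ _ (c * d k c)).
  by rewrite ler_piMr ?mulr_ge0 ?(ltW c0)// invf_le1 ?ltr0n// ler1n.
by rewrite ler_wpM2r.
Qed.

(** [beta 0] increases from the limit 0 at 0, and the recursion adds a nonnegative term. *)
Let beta_ge0_pos k (v : R) : 0 < v -> 0 <= beta k v.
Proof.
move=> v0; elim: k => [|k IH]; last first.
  by rewrite betaS// addr_ge0// divr_ge0 ?mulr_ge0 ?d_ge0// ltW.
rewrite -(cvg_lim _ beta0_cvg0)//; apply: limr_le.
  exact: cvgP beta0_cvg0.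
near=> w; apply: beta_homo_pos; first by near: w; exact: nbhs_right_gt.
by near: w; exact: nbhs_right_le.
Unshelve. all: by end_near. Qed.

Lemma beta_ge0 k (v : R) : 0 <= beta k v.
Proof. by have [/beta_neg->|/beta_ge0_pos] := leP v 0. Qed.

Lemma beta_homo k : {homo beta k : v w / v <= w}.
Proof.
move=> v w vw; have [/beta_neg->|v0] := leP v 0; first exact: beta_ge0.
exact: beta_homo_pos.
Qed.

Let beta0_le k (v : R) : beta 0 v <= beta k v.
Proof.
have [v0|v0] := leP v 0; first by rewrite !beta_neg.
elim: k => // k IH; rewrite betaS// (le_trans IH)// lerDl.
apply: divr_ge0; last exact: ler0n.
by apply: mulr_ge0; [exact: ltW|exact: d_ge0].
Qed.

(** At a large w, beta_k(w) >= beta_0(w) > 1 - e/2, while beta_k(2w) <= 1 by induction;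
    [beta_le_double] then gives beta_{k+1}(w) <= 1 + e, and monotonicity carries this to smaller
    arguments. *)
Lemma beta_le1 k (v : R) : beta k v <= 1.
Proof.
elim: k v => [|k IH] v.
  rewrite -(cvg_lim _ beta0_cvg1)//; apply: limr_ge.
    exact: cvgP beta0_cvg1.
  by near=> w; apply: beta_homo; near: w; apply: nbhs_pinfty_ge; rewrite num_real.
apply/ler_addgt0Pr => e e0.
have e20 : 0 < e / 2 by rewrite divr_gt0.
move/cvgrPdist_lt : beta0_cvg1 => /(_ _ e20) [M [_ HM]].
pose w := Num.max (Num.max v 1) (M + 1).
have vw : v <= w by rewrite !le_max lexx.
have w0 : 0 < w by rewrite !lt_max ltr01 orbT.
have Mw : M < w by rewrite lt_max ltrDl ltr01 orbT.
have := HM w Mw; rewrite ltr_norml => /andP[_ h1].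
have h2 := beta0_le k w; have h3 := beta_le_double k w0.
have h4 := IH (2 * w); have h5 := @beta_homo k.+1 v w vw.
lra.
Unshelve. all: by end_near. Qed.

Lemma beta_small k (e : R) : 0 < e ->
  exists2 a : R, 0 < a & forall v, v < a -> beta k v < e.
Proof.
move=> e0; elim: k e e0 => [|k IH] e e0.
  move/cvgrPdist_lt : beta0_cvg0 => /(_ _ e0) [a /= a0 Ha].
  exists a => // v va; have [/beta_neg->//|v0] := leP v 0.
  have := Ha v; rewrite /= !sub0r normrN gtr0_norm// normrN => /(_ va v0).
  exact/le_lt_trans/ler_norm.
(* By [beta_le_double], beta_{k+1}(v) <= 3 beta_k(2v); hence e/3 here and a/2 below. *)
have [a a0 Ha] := IH (e / 3) (divr_gt0 e0 (ltr0Sn _ _)).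
exists (a / 2); first exact: divr_gt0.
move=> v va; have [/beta_neg->//|v0] := leP v 0.
have h := Ha (2 * v); rewrite mulrC -ltr_pdivlMr// in h.
have h1 := h va; have h2 := beta_le_double k v0; have h3 := beta_ge0 k v.
rewrite [v * 2]mulrC in h1; lra.
Qed.

End bernstein_sequence.

(** * The sequence attached to a function phi *)

Section bernstein_sequence_of.
Context {R : realType} (phi : R -> R).
Hypothesis sphi : smooth_on_pos phi.
Let g := neg_deriv_sqrt phi.

(** In closed form, 2^k / (1 * 3 * ... * (2k - 1)). *)
Fixpoint bern_coef (k : nat) : R :=
  if k is k'.+1 then 2 * bern_coef k' / k'.*2.+1%:R else 1.

Lemma bern_coef_gt0 k : 0 < bern_coef k.
Proof. by elim: k => //= k IH; rewrite divr_gt0 ?mulr_gt0. Qed.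

(** A closed form whose sign can be read off the alternation of [g]; [is_derive_bern] identifies it
    as the derivative of [bern k]. *)
Definition bern_deriv (k : nat) (v : R) : R :=
  bern_coef k * (-1) ^+ k * (g^`(k)%classic (v^-1 ^+ 2) * v^-1 ^+ k.*2.+2).

(** The value 0 for v <= 0 makes each term a candidate distribution function on the whole line. *)
Fixpoint bern (k : nat) (v : R) : R :=
  if v <= 0 then 0 else
  if k is k'.+1 then bern k' v + v * bern_deriv k' v / k'.*2.+1%:R
  else phi v^-1.

Lemma bern_neg k (v : R) : v <= 0 -> bern k v = 0.
Proof. by case: k => [|k] /= ->. Qed.

Lemma bernS k (v : R) : 0 < v ->
  bern k.+1 v = bern k v + v * bern_deriv k v / k.*2.+1%:R.
Proof. by move=> v0 /=; rewrite leNgt v0. Qed.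

Lemma bern0E (v : R) : 0 < v -> bern 0 v = phi v^-1.
Proof. by move=> v0 /=; rewrite leNgt v0. Qed.

Let is_derive_inv (v : R) : 0 < v -> is_derive v 1 (fun v => v^-1) (- v^-1 ^+ 2).
Proof.
move=> v0; apply: is_derive_eq; first by apply: is_deriveV; rewrite gt_eqF.
by rewrite /GRing.scale /= mulr1 exprVn.
Qed.

Lemma is_derive_bern_deriv k (v : R) : 0 < v ->
  is_derive v 1 (bern_deriv k)
   (bern_coef k * (-1) ^+ k * (- v^-1 ^+ 2 *
     (2 * v^-1 * g^`(k.+1)%classic (v^-1 ^+ 2) * v^-1 ^+ k.*2.+2 +
      g^`(k)%classic (v^-1 ^+ 2) * (k.*2.+2%:R * v^-1 ^+ k.*2.+1)))).
Proof.
move=> v0; have w0 : 0 < v^-1 by rewrite invr_gt0.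
have sg := smooth_neg_deriv_sqrt sphi.
have Hg : is_derive v^-1 1 (fun w => g^`(k)%classic (w ^+ 2))
    (2 * v^-1 * g^`(k.+1)%classic (v^-1 ^+ 2)).
  apply: is_derive1_compM; first exact: is_derive_sqr.
  by apply: is_derive_iter => //; rewrite exprn_gt0.
have H := is_derive1_compM (is_derive_inv v0)
  (is_derive1M Hg (is_derive_expn k.*2.+2 v^-1)).
by apply: (is_derive_eq (is_deriveZ (bern_coef k * (-1) ^+ k) H)).
Qed.

(** The divisor 2k+1 is what makes the terms in g^(k) cancel: differentiating the power v^-(2k+2)
    yields -(2k+2)/(2k+1) times [bern_deriv k], against 1 + 1/(2k+1) times it from the rest. Only
    the term in g^(k+1) survives. *)
Lemma is_derive_bern k (v : R) : 0 < v ->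
  is_derive v 1 (bern k) (bern_deriv k v).
Proof.
elim: k v => [|k IH] v v0.
  apply: (is_derive_eq_pos v0 (f := fun v => phi v^-1)) => [s|].
    by move/bern0E => ->.
  have w0 : 0 < v^-1 by rewrite invr_gt0.
  apply: (is_derive_eq (is_derive1_compM (is_derive_inv v0) (is_derive_phi sphi w0))).
  by rewrite /bern_deriv /= expr0 !mul1r mulrNN mulrC.
apply: (is_derive_eq_pos v0 (f := fun v => bern k v +
    k.*2.+1%:R^-1 * (v * bern_deriv k v))) => [s s0|].
  by rewrite bernS// [_^-1 * _]mulrC.
apply: (is_derive_eq (is_deriveD (IH v v0) (is_deriveZ _
  (is_derive1M (is_derive_id v 1) (is_derive_bern_deriv k v0))))).
rewrite /GRing.scale /= /bern_deriv -derive1nS [bern_coef k.+1]/=.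
move: (g^`(k.+1)%classic _) (g^`(k)%classic _) (bern_coef k) => gS gk b.
rewrite doubleS !(exprS v^-1 _.+1) !(exprS v^-1 k.*2) (exprS (-1) k).
move: (v^-1 ^+ k.*2) ((-1) ^+ k : R) => x e.
have m0 : k.*2.+1%:R != 0 :> R by rewrite pnatr_eq0.
rewrite (_ : k.*2.+2%:R = k.*2.+1%:R + 1 :> R); last by rewrite natr1.
move: (k.*2.+1%:R : R) m0 => m m0.
by field; rewrite m0 gt_eqF.
Qed.

End bernstein_sequence_of.

(** * The mixing kernels *)

Section beta_kernel.
Context {R : realType}.
Notation mu := (@lebesgue_measure R).

(** The inverse of the integral of (1 - w^2)^n over [0, 1]. *)
Fixpoint kernel_coef (n : nat) : R :=
  if n is m.+1 then kernel_coef m * m.*2.+3%:R / m.*2.+2%:R else 1.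

Lemma kernel_coef_gt0 n : 0 < kernel_coef n.
Proof. by elim: n => //= n IH; rewrite divr_gt0 ?mulr_gt0. Qed.

(** The index is shifted: this kernel is paired with [beta n.+1]. *)
Definition beta_kernel (n : nat) (w : R) : R := kernel_coef n * (1 - w ^+ 2) ^+ n.

Definition beta_kernel_deriv (n : nat) (w : R) : R :=
  kernel_coef n * (n%:R * (1 - w ^+ 2) ^+ n.-1 * (- (2 * w))).

Lemma is_derive_beta_kernel n (w : R) :
  is_derive w 1 (beta_kernel n) (beta_kernel_deriv n w).
Proof.
have H1 : is_derive w 1 (fun w => 1 - w ^+ 2) (- (2 * w)).
  apply: (is_derive_eq (is_deriveB (is_derive_cst (1 : R) w 1) (is_derive_sqr w))).
  by rewrite sub0r.
have H2 := is_derive1_compM H1 (is_derive_expn n (1 - w ^+ 2)).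
apply: (is_derive_eq (is_deriveZ (kernel_coef n) H2)).
by rewrite /GRing.scale /= /beta_kernel_deriv; ring.
Qed.

(** This is the adjoint of the recursion for [beta]: the left side is the derivative of w *
    [beta_kernel n.+1 w], divided by 2n+3, as it appears on integrating by parts. *)
Lemma beta_kernelS n (w : R) :
  (beta_kernel n.+1 w + w * beta_kernel_deriv n.+1 w) / n.*2.+3%:R =
  beta_kernel n.+1 w - beta_kernel n w.
Proof.
rewrite /beta_kernel_deriv /beta_kernel /=; rewrite exprS.
move: (kernel_coef n) ((1 - w ^+ 2) ^+ n) => a x.
have m0 : n.*2.+3%:R != 0 :> R by rewrite pnatr_eq0.
have m1 : n.*2.+2%:R != 0 :> R by rewrite pnatr_eq0.
have e1 : n.+1%:R = n.*2.+2%:R / 2 :> R.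
  by rewrite -doubleS -mul2n natrM mulrC mulKf.
rewrite e1; have e2 : n.*2.+3%:R = n.*2.+2%:R + 1 :> R by rewrite natr1.
move: m0; rewrite e2.
move: (n.*2.+2%:R : R) m1 => m m1 m0.
by field; rewrite m0 m1.
Qed.

Section representation.
Variables (beta d : nat -> R -> R).
Hypothesis dbeta : forall k (v : R), 0 < v -> is_derive v 1 (beta k) (d k v).
Hypothesis betaS : forall k (v : R), 0 < v ->
  beta k.+1 v = beta k v + v * d k v / k.*2.+1%:R.
Hypothesis cbeta : forall k, beta k v @[v --> 0^'+] --> beta k 0.

(* Integrating beta_kernel n w * beta n.+1 (v * w) by parts repeatedly lowers the
   index of beta to 0; the terms of this sum are the boundary terms. *)
Fixpoint kernel_primitive (v : R) (n : nat) (w : R) : R :=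
  w * beta_kernel n w * beta n (v * w) / n.*2.+1%:R +
  (if n is m.+1 then kernel_primitive v m w else 0).

Let is_derive_beta_scale (v w : R) n : 0 < v -> 0 < w ->
  is_derive w 1 (fun w => beta n (v * w)) (v * d n (v * w)).
Proof.
move=> v0 w0; apply: is_derive1_compM; last by apply: dbeta; rewrite mulr_gt0.
apply: (is_derive_eq (is_deriveZ v (is_derive_id w 1))).
by rewrite /GRing.scale /= mulr1.
Qed.

(** Writing b_k for [beta_kernel k], the k-th term has derivative b_k beta_{k+1} - b_{k-1} beta_k,
    without the second part when k = 0, so the sum telescopes. *)
Lemma is_derive_kernel_primitive (v w : R) n : 0 < v -> 0 < w ->
  is_derive w 1 (kernel_primitive v n) (beta_kernel n w * beta n.+1 (v * w)).
Proof.
move=> v0 w0; have vw0 : 0 < v * w by rewrite mulr_gt0.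
have term k : is_derive w 1
    (fun w => w * beta_kernel k w * beta k (v * w) / k.*2.+1%:R)
    ((beta_kernel k w + w * beta_kernel_deriv k w) / k.*2.+1%:R * beta k (v * w) +
     beta_kernel k w * (beta k.+1 (v * w) - beta k (v * w))).
  have H := is_derive1M (is_derive1M (is_derive_id w 1)
    (is_derive_beta_kernel k w)) (is_derive_beta_scale k v0 w0).
  apply: (is_derive_eq (is_derive1M H (is_derive_cst (k.*2.+1%:R^-1 : R) w 1))).
  by rewrite betaS// /=; ring.
elim: n => [|n IH].
  apply: (is_derive_eq (is_deriveD (term 0%N) (is_derive_cst (0 : R) w 1))).
  by rewrite /beta_kernel /beta_kernel_deriv /= !expr0 mulr0n invr1; ring.
apply: (is_derive_eq (is_deriveD (term n.+1) IH)).
by rewrite doubleS beta_kernelS; ring.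
Qed.

(** At w = 1 every kernel except the zeroth vanishes. *)
Lemma kernel_primitive1 (v : R) n : kernel_primitive v n 1 = beta 0 v.
Proof.
elim: n => [|n IH] /=; first by rewrite /beta_kernel /= expr0 !mulr1 mul1r addr0 divr1.
by rewrite IH /beta_kernel expr1n subrr expr0n /= !(mulr0, mul0r) add0r.
Qed.

Lemma kernel_primitive0 (v : R) n : kernel_primitive v n 0 = 0.
Proof. by elim: n => [|n IH] /=; rewrite ?IH !mul0r addr0. Qed.

Let cvg_beta_scale (v : R) k : 0 < v ->
  beta k (v * w) @[w --> 0^'+] --> beta k (v * 0).
Proof.
move=> v0; rewrite mulr0; apply/cvgrPdist_lt => e e0.
have := @cbeta k; move/cvgrPdist_lt => /(_ e e0) [a /= a0 Ha].
near=> w; have w0 : 0 < w by near: w; exact: nbhs_right_gt.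
apply: Ha; rewrite /= ?mulr_gt0// sub0r normrN gtr0_norm ?mulr_gt0//.
rewrite mulrC -ltr_pdivlMr//; near: w; apply: nbhs_right_lt.
exact: divr_gt0.
Unshelve. all: by end_near. Qed.

(** The fundamental theorem of calculus for [kernel_primitive], with w = r / L; the free scale L
    prepares the passage to the limit. *)
Lemma kernel_representation (v L : R) n : 0 < v -> 0 < L ->
  (\int[mu]_(r in `[0%R, L])
    (beta_kernel n (r / L) / L * beta n.+1 (v * (r / L)))%:E = (beta 0 v)%:E)%E.
Proof.
move=> v0 L0.
have Hs (r : R) : is_derive r 1 (fun r => r / L) L^-1.
  apply: (is_derive_eq (is_derive1M (is_derive_id r 1) (is_derive_cst (L^-1 : R) r 1))).
  by rewrite /= mulr0 addr0 mul1r.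
have dE (r : R) : 0 < r -> is_derive r 1 (fun r => kernel_primitive v n (r / L))
    (beta_kernel n (r / L) / L * beta n.+1 (v * (r / L))).
  move=> r0; have rL : 0 < r / L by rewrite divr_gt0.
  apply: (is_derive_eq (is_derive1_compM (Hs r) (is_derive_kernel_primitive n v0 rL))).
  by ring.
(* Differentiability of [beta] is known only on the open half-line, so continuity at the end point 0
   comes from right limits. *)
have cscale k : beta k (v * (r / L)) @[r --> 0^'+] --> beta k (v * (0 / L)).
  have := @cvg_beta_scale (v / L) k (divr_gt0 v0 L0).
  rewrite !mulr0 mul0r mulr0; apply: cvg_trans; apply: near_eq_cvg.
  by near=> r; congr (beta k _); ring.
have cr : (r / L) @[r --> 0^'+] --> 0 / L.
  by apply: cvg_at_right_filter; exact: (is_derive_continuous (Hs 0)).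
have ck k : beta_kernel k (r / L) @[r --> 0^'+] --> beta_kernel k (0 / L).
  apply: cvg_at_right_filter.
  exact: (is_derive_continuous (is_derive1_compM (Hs 0) (is_derive_beta_kernel k _))).
have cE k : kernel_primitive v k (r / L) @[r --> 0^'+] --> kernel_primitive v k (0 / L).
  elim: k => [|k IH] /=.
    by apply: cvgD; [apply: cvgMr_tmp; apply: cvgM => //; exact: cvgM|exact: cvg_cst].
  by apply: cvgD => //; apply: cvgMr_tmp; apply: cvgM => //; exact: cvgM.
rewrite (@continuous_FTC2 R _ (fun r => kernel_primitive v n (r / L)))//.
- by rewrite mul0r divff ?gt_eqF// kernel_primitive1 kernel_primitive0 sube0.
- apply/continuous_within_itvP => //.
  have cont (r : R) : 0 < r -> {for r, continuous
      (fun r : R => beta_kernel n (r / L) / L * beta n.+1 (v * (r / L)) : R)}.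
    move=> r0; have rL : 0 < r / L by rewrite divr_gt0.
    have H1 := is_derive1_compM (Hs r) (is_derive_beta_kernel n (r / L)).
    have H2 := is_derive1_compM (Hs r) (is_derive_beta_scale n.+1 v0 rL).
    exact: is_derive_continuous (is_derive1M
      (is_derive1M H1 (is_derive_cst (L^-1 : R) r 1)) H2).
  split.
  + by move=> r; rewrite in_itv/= => /andP[r0 _]; exact: cont.
  + by apply: cvgM => //; exact: cvgMr_tmp.
  + by apply: cvg_at_left_filter; exact: cont.
- split => //.
  + by move=> r; rewrite in_itv/= => /andP[r0 _]; case: (dE r r0).
  + by apply: cvg_at_left_filter; exact: (is_derive_continuous (dE _ L0)).
- by move=> r; rewrite in_itv/= => /andP[r0 _]; exact/is_derive1E/dE.
Unshelve. all: by end_near. Qed.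

End representation.
End beta_kernel.

(** * Convergence of the rescaled kernels to the half-normal density *)

Section rescaled_kernel.
Context {R : realType}.
Notation mu := (@lebesgue_measure R).

(** With this scale, (r / [kernel_scale n])^2 = (r^2 / 2) / (n+1), whence the limit exp(-r^2 /
    2). *)
Definition kernel_scale (n : nat) : R := Num.sqrt n.*2.+2%:R.

Lemma kernel_scale_gt0 n : 0 < kernel_scale n.
Proof. by rewrite sqrtr_gt0. Qed.

(** Extension by 0 beyond the scale lets all kernels be integrated over the same half-line. *)
Definition kernel_shape (n : nat) (r : R) : R :=
  if r <= kernel_scale n then (1 - r ^+ 2 / 2 / n.+1%:R) ^+ n else 0.

Definition rescaled_kernel (n : nat) (r : R) : R :=
  kernel_coef n / kernel_scale n * kernel_shape n r.

Let sqr_scale (n : nat) (r : R) : (r / kernel_scale n) ^+ 2 = r ^+ 2 / 2 / n.+1%:R.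
Proof.
rewrite exprMn exprVn sqr_sqrtr// -doubleS -mul2n natrM invfM.
by rewrite mulrA.
Qed.

Lemma rescaled_kernel_integral n (f : R -> R) :
  (\int[mu]_(r in `[0%R, +oo[) (rescaled_kernel n r * f r)%:E =
   \int[mu]_(r in `[0%R, kernel_scale n])
     (beta_kernel n (r / kernel_scale n) / kernel_scale n * f r)%:E)%E.
Proof.
rewrite [LHS]integral_mkcond [RHS]integral_mkcond; apply: eq_integral => r _.
rewrite /patch !mem_setE !in_itv/= andbT.
rewrite /rescaled_kernel /kernel_shape /beta_kernel sqr_scale.
case: (leP 0 r) => //= r0; case: ifPn => // _; last by rewrite mulr0 mul0r.
by congr (_ * _)%:E; rewrite mulrAC.
Qed.

Lemma kernel_shape_ge0 n r : 0 <= r -> 0 <= kernel_shape n r.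
Proof.
move=> r0; rewrite /kernel_shape; case: ifPn => // rL.
rewrite -sqr_scale exprn_ge0// subr_ge0 exprn_ile1//.
  by rewrite divr_ge0// ltW// kernel_scale_gt0.
by rewrite ler_pdivrMr ?kernel_scale_gt0// mul1r.
Qed.

(** With c = r^2 / 2 and y = c / (n+1), the inequality 1 - y <= e^(-y) gives (1 - y)^n <= e^(-ny) =
    e^(-c) e^y. *)
Lemma kernel_shape_le n r : 0 <= r ->
  kernel_shape n r <= expR (- (r ^+ 2 / 2)) * expR (r ^+ 2 / 2 / n.+1%:R).
Proof.
move=> r0; rewrite /kernel_shape; case: ifPn => rL; last first.
  by rewrite mulr_ge0 ?expR_ge0.
have y1 : r ^+ 2 / 2 / n.+1%:R <= 1.
  rewrite -sqr_scale exprn_ile1//.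
    by rewrite divr_ge0// ltW// kernel_scale_gt0.
  by rewrite ler_pdivrMr ?kernel_scale_gt0// mul1r.
set c := r ^+ 2 / 2 in y1 *; set y := c / n.+1%:R in y1 *.
have ec : c = y * n.+1%:R by rewrite /y divfK// pnatr_eq0.
rewrite -expRD {1}ec (_ : - (y * n.+1%:R) + y = n%:R * - y); last by rewrite -natr1; ring.
rewrite expRM_natl.
by rewrite lerXn2r ?nnegrE ?expR_ge0 ?subr_ge0// expR_ge1Dx.
Qed.

Lemma bernoulli_ineq (x : R) n : 0 <= x <= 1 -> 1 - n%:R * x <= (1 - x) ^+ n.
Proof.
move=> /andP[x0 x1]; elim: n => [|n IH]; first by rewrite mul0r subr0 expr0.
rewrite exprS -natr1; apply: (@le_trans _ _ ((1 - x) * (1 - n%:R * x))).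
  have : 0 <= n%:R * (x * x) by rewrite !mulr_ge0.
  lra.
by rewrite ler_wpM2l// subr_ge0.
Qed.

(* (1 - c / N) * expR (c / N) >= 1 - (c / N) ^+ 2 with c = r ^+ 2 / 2 and
   N = n.+1; then take N-th powers. *)
Lemma kernel_shape_ge n r : 0 <= r -> r <= kernel_scale n ->
  expR (- (r ^+ 2 / 2)) * (1 - (r ^+ 2 / 2) ^+ 2 / n.+1%:R) <= kernel_shape n r.
Proof.
move=> r0 rL; rewrite /kernel_shape rL.
have y1 : r ^+ 2 / 2 / n.+1%:R <= 1.
  rewrite -sqr_scale exprn_ile1//.
    by rewrite divr_ge0// ltW// kernel_scale_gt0.
  by rewrite ler_pdivrMr ?kernel_scale_gt0// mul1r.
have c0 : 0 <= r ^+ 2 / 2 by rewrite divr_ge0// sqr_ge0.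
set c := r ^+ 2 / 2 in c0 y1 *.
have y0 : 0 <= c / n.+1%:R by rewrite divr_ge0.
set y := c / n.+1%:R in y0 y1 *.
have ec : c = n.+1%:R * y by rewrite /y mulrC divfK// pnatr_eq0.
apply: (@le_trans _ _ ((1 - y) ^+ n.+1)); last first.
  by rewrite exprS ler_piMl ?exprn_ge0 ?subr_ge0// gerBl.
rewrite expRN mulrC ler_pdivrMr ?expR_gt0//.
apply: (@le_trans _ _ ((1 - y ^+ 2) ^+ n.+1)).
  apply: le_trans (bernoulli_ineq n.+1 _); last first.
    by rewrite sqr_ge0 exprn_ile1.
  have n0 : n.+1%:R != 0 :> R by rewrite pnatr_eq0.
  by rewrite (_ : c ^+ 2 / n.+1%:R = n.+1%:R * y ^+ 2)// /y; field.
rewrite ec expRM_natl -exprMn lerXn2r ?nnegrE//.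
- by rewrite subr_ge0 exprn_ile1.
- by rewrite mulr_ge0 ?subr_ge0// expR_ge0.
rewrite (_ : 1 - y ^+ 2 = (1 - y) * (1 + y)); last by ring.
by rewrite ler_wpM2l ?subr_ge0// expR_ge1Dx.
Qed.

Let kernel_scale_large (r : R) : 0 <= r -> \forall n \near \oo, r <= kernel_scale n.
Proof.
move=> r0; exists (Num.truncn (r ^+ 2)).+1 => //= n rn.
rewrite -[r]ger0_norm// -sqrtr_sqr ler_wsqrtr//.
rewrite (le_trans (ltW (truncnS_gt (r ^+ 2))))// ler_nat (leq_trans rn)//.
by rewrite -addnn -!addnS leq_addr.
Qed.

Lemma cvg_kernel_shape (r : R) : 0 <= r ->
  kernel_shape n r @[n --> \oo] --> expR (- (r ^+ 2 / 2)).
Proof.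
move=> r0; set c := r ^+ 2 / 2.
have cN (b : R) : b / n.+1%:R @[n --> \oo] --> (0 : R).
  rewrite -(mulr0 b); apply: cvgMl_tmp; exact: cvg_harmonic.
apply: (@squeeze_cvgr _ _ _ _
  (fun n => expR (- c) * (1 - c ^+ 2 / n.+1%:R))
  (fun n => expR (- c) * expR (c / n.+1%:R))).
- near=> n; rewrite kernel_shape_le// andbT kernel_shape_ge//.
  by near: n; exact: kernel_scale_large.
- rewrite -[X in _ --> X]mulr1 -[X in _ * X]subr0; apply: cvgMl_tmp.
  by apply: cvgB; [exact: cvg_cst|exact: cN].
- rewrite -[X in _ --> X]mulr1 -[X in _ * X]expR0; apply: cvgMl_tmp.
  by apply: continuous_cvg; [exact: continuous_expR|exact: cN].
Unshelve. all: by end_near. Qed.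

Lemma kernel_shape_dom n (r : R) : 0 <= r ->
  kernel_shape n r <= expR 1 * expR (- (r ^+ 2 / 2)).
Proof.
move=> r0; have [rL|rL] := leP r (kernel_scale n); last first.
  by rewrite /kernel_shape (lt_geF rL) mulr_ge0 ?expR_ge0.
apply: (le_trans (kernel_shape_le n r0)); rewrite mulrC ler_wpM2r ?expR_ge0//.
rewrite ler_expR -sqr_scale exprn_ile1//.
  by rewrite divr_ge0// ltW// kernel_scale_gt0.
by rewrite ler_pdivrMr ?kernel_scale_gt0// mul1r.
Qed.

Lemma measurable_kernel_shape n : measurable_fun [set: R] (kernel_shape n).
Proof.
apply: measurable_fun_ifT => //; first exact: measurable_fun_ler.
apply: measurable_funX; apply: measurable_funB => //.
by apply: measurable_funM => //; apply: measurable_funM => //; exact: measurable_funX.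
Qed.

Lemma half_normal_pdf_integral :
  (\int[mu]_(r in `[0%R, +oo[) (half_normal_pdf r)%:E = 1)%E.
Proof. by rewrite -half_normal_tailE half_normal_tail0. Qed.

Let gaussE (r : R) : expR (- (r ^+ 2 / 2)) = (2 * normal_peak 1)^-1 * half_normal_pdf r.
Proof.
by rewrite half_normal_pdfE mulKf// mulf_neq0// gt_eqF// normal_peak_gt0.
Qed.

(** The constant family 1 satisfies the recursion with zero derivatives, so the kernel
    representation applies to it. *)
Lemma rescaled_kernel_mass n :
  (\int[mu]_(r in `[0%R, +oo[) (rescaled_kernel n r)%:E = 1)%E.
Proof.
pose one (k : nat) : R -> R := cst 1; pose zero (k : nat) : R -> R := cst 0.
have d1 k (v : R) : 0 < v -> is_derive v 1 (one k) (zero k v).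
  by move=> _; exact: is_derive_cst.
have S1 k (v : R) : 0 < v -> one k.+1 v = one k v + v * zero k v / k.*2.+1%:R.
  by move=> _; rewrite /zero /= mulr0 mul0r addr0.
have c1 k : one k v @[v --> 0^'+] --> one k 0 by exact: cvg_cst.
rewrite -[RHS](kernel_representation d1 S1 c1 n ltr01 (kernel_scale_gt0 n)).
rewrite -rescaled_kernel_integral; apply: eq_integral => r _.
by rewrite /one /= mulr1.
Qed.

(** Dominated convergence of the shapes determines the limit of the normalizing constants, in place
    of Wallis' product. *)
Lemma cvg_rescaled_kernel (r : R) : 0 <= r ->
  rescaled_kernel n r @[n --> \oo] --> half_normal_pdf r.
Proof.
move=> r0.
pose D : set (measurableTypeR R) := `[0, +oo[%classic.
have mD : measurable D by exact: measurable_itv.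
have D0 s : D s -> 0 <= s by rewrite /D /= in_itv/= andbT.
pose c : R := 2 * normal_peak 1.
have c0 : 0 < c by rewrite mulr_gt0// normal_peak_gt0// oner_neq0.
have ig : mu.-integrable D (fun s => (expR 1 * expR (- (s ^+ 2 / 2)))%:E).
  have ip : mu.-integrable D (fun s => (normal_pdf 0 1 s)%:E).
    exact: (integrableS _ _ (@subsetT _ _) (integrable_normal_pdf 0 1)).
  have := @integrableZl _ _ _ mu D mD (expR 1 * (c^-1 * 2)) _ ip.
  apply: eq_integrable => // s _.
  by rewrite gaussE /half_normal_pdf -EFinM !mulrA.
have [||||_ _ H] := @dominated_convergence _ _ R mu D mD
  (fun n s => (kernel_shape n s)%:E) (fun s => (expR (- (s ^+ 2 / 2)))%:E)
  (fun s => (expR 1 * expR (- (s ^+ 2 / 2)))%:E) _ _ _ ig _.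
- by move=> n; apply/measurable_funTS/measurable_EFinP; exact: measurable_kernel_shape.
- apply/measurable_funTS/measurable_EFinP; apply: measurableT_comp => //.
  by apply: measurableT_comp => //; apply: measurable_funM => //; exact: measurable_funX.
- apply: aeW => s /D0 s0; apply: cvg_EFin; first exact: nearW.
  exact: cvg_kernel_shape.
- apply: aeW => s n /D0 s0; rewrite lee_fin ger0_norm ?kernel_shape_ge0//.
  exact: kernel_shape_dom.
have JE : (\int[mu]_(s in D) (expR (- (s ^+ 2 / 2)))%:E = (c^-1)%:E)%E.
  under eq_integral do rewrite gaussE EFinM.
  rewrite ge0_integralZl//=.
  - by rewrite half_normal_pdf_integral mule1.
  - by apply/measurable_funTS/measurable_EFinP; exact: measurable_half_normal_pdf.
  - by move=> s _; rewrite lee_fin half_normal_pdf_ge0.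
  - by rewrite lee_fin invr_ge0 ltW.
rewrite JE in H.
pose a n := kernel_coef n / kernel_scale n.
have a0 n : 0 < a n by rewrite divr_gt0 ?kernel_coef_gt0 ?kernel_scale_gt0.
(* The kernels have mass 1, so their normalizing constants are the inverses of
   the integrals of the shapes. *)
have aE n : (\int[mu]_(s in D) (kernel_shape n s)%:E = ((a n)^-1)%:E)%E.
  have := rescaled_kernel_mass n; rewrite /rescaled_kernel.
  under eq_integral do rewrite EFinM.
  rewrite ge0_integralZl//=.
  - rewrite -/(a n) => /(congr1 (fun x => ((a n)^-1)%:E * x)%E).
    by rewrite muleA -EFinM mulVf ?gt_eqF// mul1e mule1.
  - by apply/measurable_funTS/measurable_EFinP; exact: measurable_kernel_shape.
  - by move=> s /D0 s0; rewrite lee_fin kernel_shape_ge0.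
  - by rewrite lee_fin; exact: ltW (a0 n).
have Ha : (a n)^-1 @[n --> \oo] --> c^-1.
  have {}H : (((a n)^-1)%:E @[n --> \oo] --> (c^-1)%:E)%E.
    apply: cvg_trans H; apply: near_eq_cvg; apply: nearW => n /=.
    by rewrite aE.
  exact: fine_cvg H.
have {}Ha : a n @[n --> \oo] --> c.
  rewrite -[c]invrK (_ : a = fun n => (a n)^-1^-1); last first.
    by apply/funext => n; rewrite invrK.
  by apply: cvgV => //; rewrite invr_eq0 gt_eqF.
rewrite half_normal_pdfE; apply: cvgM => //.
exact: cvg_kernel_shape.
Qed.

End rescaled_kernel.

(** * Helly's selection theorem *)

Lemma fmap_ultra (T U : Type) (f : T -> U) (F : set_system T) :
  UltraFilter F -> UltraFilter (f @ F).
Proof.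
move=> UF; split=> [|G PG FG]; first exact: fmap_proper_filter.
rewrite predeqE => A; split=> [GA|]; last exact: FG.
have [//|FnA] := in_ultra_setVsetC (f @^-1` A) UF.
have /(filterI GA) : G (~` A) by exact: FG.
by rewrite setICr => /filter_not_empty.
Qed.

Section helly.
Context {R : realType} (F : nat -> R -> R).
Hypothesis F_homo : forall n, {homo F n : x y / x <= y}.
Hypothesis F01 : forall n x, 0 <= F n x <= 1.

(** By compactness of [0, 1], one ultrafilter finer than \oo gives limits at all points at once,
    with no diagonal argument. *)
Let ultra_limit : exists2 U : set_system nat, UltraFilter U /\ (\oo `<=` U) &
  exists G : R -> R, forall x, F n x @[n --> U] --> G x.
Proof.
have [U [UU ooU]] := ultraFilterLemma (@eventually_filter).
exists U => //.
suff ex x : exists y : R, F n x @[n --> U] --> y.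
  by have [G HG] := choice ex; exists G.
 have := @segment_compact R 0 1; rewrite compact_ultra => /(_ (F^~ x @ U)).
have UF : UltraFilter (F^~ x @ U) by exact: fmap_ultra.
case=> [|y [_ xy]]; last by exists y.
by apply: (@filterE _ U) => n; rewrite /= in_itv; exact: F01.
Qed.

(** [H] is the right-continuous regularization of the ultrafilter limit. The two final bounds stand
    for convergence at continuity points; a sequence is extracted because Fatou's lemma is applied
    along it. *)
Lemma helly : exists (s : nat -> nat) (H : R -> R),
  [/\ forall n, (n <= s n)%N, {homo H : x y / x <= y},
      forall x, 0 <= H x <= 1, right_continuous H &
    (forall x e, 0 < e -> \forall n \near \oo, F (s n) x <= H x + e) /\
    (forall x y e, x < y -> 0 < e -> \forall n \near \oo, H x - e <= F (s n) y)].
Proof.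
have [U [UU ooU] [G FG]] := ultra_limit.
have G_homo : {homo G : x y / x <= y}.
  move=> x y xy; apply: (ler_cvg_to (FG x) (FG y)).
  by apply: filterE => n; exact: F_homo.
have G01 x : 0 <= G x <= 1.
  apply/andP; split.
    apply: (ler_cvg_to (cvg_cst 0) (FG x)); apply: filterE => n.
    by have /andP[] := F01 n x.
  apply: (ler_cvg_to (FG x) (cvg_cst (1 : R))); apply: filterE => n.
  by have /andP[] := F01 n x.
(* [s n] will be accurate to 1/(n+1) at the rationals with code below [n]: finitely many conditions,
   each holding along [U]. *)
have exs n : exists k, (n <= k)%N /\
    forall i q, (i < n)%N -> unpickle i = Some q :> option rat ->
    `|G (ratr q) - F k (ratr q)| < n.+1%:R^-1.
  suff [k ?] : [set k | (n <= k)%N /\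
      forall i q, (i < n)%N -> unpickle i = Some q :> option rat ->
      `|G (ratr q) - F k (ratr q)| < n.+1%:R^-1] !=set0 by exists k.
  apply: (@filter_ex _ U); apply: filterI.
    by apply: ooU; exact: nbhs_infty_ge.
  elim: {1}n => [|m IH]; first by apply: filterE.
  have := IH; case E : (unpickle m : option rat) => [q|].
    have /cvgrPdist_lt /(_ n.+1%:R^-1) := FG (ratr q).
    rewrite invr_gt0 ltr0n => /(_ isT); apply: filterS2 => k Hq Hk i q'.
    rewrite ltnS leq_eqVlt => /orP[/eqP ->|im]; last exact: Hk.
    by rewrite E => -[<-].
  apply: filterS => k Hk i q'.
  rewrite ltnS leq_eqVlt => /orP[/eqP ->|im]; last exact: Hk.
  by rewrite E.
have [s Hs] := choice exs.
have FsG q (e : R) : 0 < e -> \forall n \near \oo, `|G (ratr q) - F (s n) (ratr q)| < e.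
  move=> e0; near=> n.
  have [_ /(_ (pickle q) q)] := Hs n; rewrite pickleK.
  move=> /(_ _ erefl) /lt_trans; apply.
    by near: n; exact: nbhs_infty_gt.
  by near: n; exact: near_infty_natSinv_lt (PosNum e0).
(* Taking the infimum of [G] strictly to the right of [x] forces right continuity. *)
pose S x := [set G y | y in `]x, +oo[%classic].
have S_lb x : has_inf (S x).
  split; first by exists (G (x + 1)); exists (x + 1) => //=; rewrite in_itv/= ltrDl ltr01.
  by exists 0 => _ [y _ <-]; have /andP[] := G01 y.
pose H x := inf (S x).
have HG x y : x < y -> H x <= G y.
  move=> xy; apply: ge_inf; first by case: (S_lb x).
  by exists y => //=; rewrite in_itv/= xy.
have Hinf x e : 0 < e -> exists2 y, x < y & G y < H x + e.
  move=> e0; have [_ [y yx <-] ye] := inf_adherent e0 (S_lb x).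
  by exists y => //; move: yx; rewrite /= in_itv/= andbT.
have GH x : G x <= H x.
  apply: lb_le_inf; first by case: (S_lb x).
  by move=> _ [y /= +  <-]; rewrite in_itv/= andbT => xy; exact/G_homo/ltW.
have H_homo : {homo H : x y / x <= y}.
  move=> x y; rewrite le_eqVlt => /predU1P[->//|xy].
  exact: le_trans (HG _ _ xy) (GH y).
exists s, H; split => //.
- by move=> n; case: (Hs n).
- move=> x; apply/andP; split.
    by apply: le_trans (GH x); case/andP: (G01 x).
  by apply: (@le_trans _ _ (G (x + 1))); [rewrite HG// ltrDl|case/andP: (G01 (x + 1))].
- move=> x; apply/cvgrPdist_lt => e e0.
  have [y xy Gy] := Hinf x e e0.
  near=> z; have xz : H x <= H z.
    by apply/H_homo/ltW; near: z; exact: nbhs_right_gt.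
  rewrite distrC ger0_norm ?subr_ge0//.
  rewrite ltrBlDl; apply: le_lt_trans Gy; apply: HG.
  by near: z; exact: nbhs_right_lt.
- split=> [x e e0|x y e xy e0].
    have e20 : 0 < e / 2 by rewrite divr_gt0.
    have [y xy Gy] := Hinf x _ e20.
    have [q] := rat_in_itvoo xy; rewrite in_itv/= => /andP[xq qy].
    apply: filterS (FsG q _ e20) => n; rewrite ltr_norml => /andP[h _].
    have h1 := F_homo (s n) (ltW xq); have h2 := G_homo _ _ (ltW qy).
    lra.
  have [q] := rat_in_itvoo xy; rewrite in_itv/= => /andP[xq qy].
  apply: filterS (FsG q _ e0) => n; rewrite ltr_norml => /andP[_ h].
  have h1 := F_homo (s n) (ltW qy); have h2 := HG _ _ xq.
  lra.
Unshelve. all: by end_near. Qed.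

End helly.

(** * The limit representation *)

Lemma fatou_cvg d (T : measurableType d) (R : realType)
    (mu : {measure set T -> \bar R}) (D : set T) (f : nat -> T -> R) (g : T -> R)
    (c : \bar R) : measurable D ->
  (forall n, measurable_fun D (f n)) ->
  (forall n x, D x -> 0 <= f n x) ->
  (forall x, D x -> f n x @[n --> \oo] --> g x) ->
  (forall n, \int[mu]_(x in D) (f n x)%:E <= c)%E ->
  (\int[mu]_(x in D) (g x)%:E <= c)%E.
Proof.
move=> mD mf f0 fg fc.
have -> : (\int[mu]_(x in D) (g x)%:E =
    \int[mu]_(x in D) limn_einf (fun n => (f n x)%:E))%E.
  apply: eq_integral => x /set_mem Dx; apply/esym.
  have H : ((f n x)%:E @[n --> \oo] --> (g x)%:E)%E.
    by apply: cvg_EFin; [exact: nearW|exact: fg].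
  by have [-> _] := cvg_limn_einf_sup H.
apply: (le_trans (fatou mu mD _ _)).
- by move=> n; apply/measurable_EFinP; exact: mf.
- by move=> n x Dx; rewrite lee_fin f0.
rewrite limn_einf_lim; apply: lime_le; first exact: is_cvg_einfs.
apply: nearW => n; apply: le_trans (fc n).
by apply: ge_ereal_inf; exists (\int[mu]_(x in D) (f n x)%:E)%E => //; exists n => /=.
Qed.

Section half_normal_representation.
Context {R : realType} (beta d : nat -> R -> R).
Notation mu := (@lebesgue_measure R).
Hypothesis dbeta : forall k (v : R), 0 < v -> is_derive v 1 (beta k) (d k v).
Hypothesis d_ge0 : forall k (v : R), 0 < v -> 0 <= d k v.
Hypothesis betaS : forall k (v : R), 0 < v ->
  beta k.+1 v = beta k v + v * d k v / k.*2.+1%:R.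
Hypothesis beta_neg : forall k (v : R), v <= 0 -> beta k v = 0.
Hypothesis beta0_cvg0 : beta 0 v @[v --> 0^'+] --> (0 : R).
Hypothesis beta0_cvg1 : beta 0 v @[v --> +oo] --> (1 : R).

Let homo_beta k : {homo beta k : v w / v <= w}.
Proof. exact: (beta_homo dbeta d_ge0 betaS beta_neg beta0_cvg0). Qed.

Let beta_ge0' k v : 0 <= beta k v.
Proof. exact: (beta_ge0 dbeta d_ge0 betaS beta_neg beta0_cvg0). Qed.

Let beta_le1' k v : beta k v <= 1.
Proof. exact: (beta_le1 dbeta d_ge0 betaS beta_neg beta0_cvg0 beta0_cvg1). Qed.

Let cbeta k : beta k v @[v --> 0^'+] --> beta k 0.
Proof.
rewrite beta_neg//; apply/cvgrPdist_lt => e e0.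
have [a a0 Ha] := beta_small dbeta d_ge0 betaS beta_neg beta0_cvg0 k e0.
near=> v; rewrite sub0r normrN ger0_norm//; apply: Ha.
by near: v; exact: nbhs_right_lt.
Unshelve. all: by end_near. Qed.

(** The rescaling of the kernel is moved into the distribution function. *)
Let F n x := beta n.+1 (x / kernel_scale n).

Let F_homo n : {homo F n : x y / x <= y}.
Proof.
by move=> x y xy; apply: homo_beta; rewrite ler_wpM2r// invr_ge0 ltW// kernel_scale_gt0.
Qed.

Let F01 n x : 0 <= F n x <= 1.
Proof. by rewrite beta_ge0' beta_le1'. Qed.

Let P n := @rescaled_kernel R n.
Let D : set (measurableTypeR R) := `]0, +oo[%classic.
Let mD : measurable D. Proof. exact: measurable_itv. Qed.
Let D0 r : D r -> 0 < r. Proof. by rewrite /D /= in_itv/= andbT. Qed.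

Let P_ge0 n r : D r -> 0 <= P n r.
Proof.
move=> /D0 /ltW r0; rewrite /P /rescaled_kernel mulr_ge0// ?kernel_shape_ge0//.
by rewrite divr_ge0 ?ltW ?kernel_coef_gt0 ?kernel_scale_gt0.
Qed.

Let mP n : measurable_fun [set: R] (P n).
Proof. by apply: measurable_funM => //; exact: measurable_kernel_shape. Qed.

Let homo_measurable (f : R -> R) (v : R) : 0 < v -> {homo f : x y / x <= y} ->
  measurable_fun [set: R] (fun r => f (v * r)).
Proof.
move=> v0 hf; apply: nondecreasing_measurable => // x y xy.
by apply: hf; rewrite ler_wpM2l// ltW.
Qed.

Let integralD (f : R -> R) : measurable_fun [set: R] f ->
  (\int[mu]_(r in D) (f r)%:E = \int[mu]_(r in `[0%R, +oo[) (f r)%:E)%E.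
Proof.
move=> mf; apply: (@integral_itv_obnd_cbnd _ 0 +oo%O).
exact/measurable_funTS/measurable_EFinP.
Qed.

Let kernel_eq n (v : R) : 0 < v ->
  (\int[mu]_(r in D) (P n r * F n (v * r))%:E = (beta 0 v)%:E)%E.
Proof.
move=> v0; rewrite integralD; last first.
  by apply: measurable_funM => //; apply: homo_measurable => //; exact: F_homo.
rewrite rescaled_kernel_integral.
rewrite -(kernel_representation dbeta betaS cbeta n v0 (kernel_scale_gt0 n)).
by apply: eq_integral => r _; rewrite /F mulrA.
Qed.

Let kernel_mass n : (\int[mu]_(r in D) (P n r)%:E = 1)%E.
Proof. by rewrite integralD// rescaled_kernel_mass. Qed.

Let pdf_mass : (\int[mu]_(r in D) (half_normal_pdf r)%:E = 1)%E.
Proof.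
rewrite integralD ?half_normal_pdf_integral//.
exact: measurable_half_normal_pdf.
Qed.

(** Fatou's lemma only bounds integrals from above; passing to 1 - f turns such a bound into one
    from below. *)
Let compl_integral (p f : R -> R) : measurable_fun [set: R] p ->
  measurable_fun [set: R] f -> (forall r, D r -> 0 <= p r) ->
  (forall r, 0 <= f r <= 1) -> (\int[mu]_(r in D) (p r)%:E = 1)%E ->
  (\int[mu]_(r in D) (p r * (1 - f r))%:E + \int[mu]_(r in D) (p r * f r)%:E = 1)%E.
Proof.
move=> mp mf p0 f01 p1; rewrite -ge0_integralD//=.
- rewrite -[RHS]p1; apply: eq_integral => r _; rewrite -EFinD; congr _%:E; ring.
- by move=> r /p0 pr; rewrite lee_fin mulr_ge0// subr_ge0; case/andP: (f01 r).
- apply/measurable_funTS/measurable_EFinP; apply: measurable_funM => //.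
  exact: measurable_funB.
- by move=> r /p0 pr; rewrite lee_fin mulr_ge0//; case/andP: (f01 r).
- by apply/measurable_funTS/measurable_EFinP; exact: measurable_funM.
Qed.

(** One inequality is Fatou's lemma for p H, the other is Fatou's lemma for p (1 - H), as all
    kernels and p have mass 1. *)
Lemma half_normal_representation : exists H : R -> R,
  [/\ {homo H : x y / x <= y}, forall x, 0 <= H x <= 1, right_continuous H,
      forall x, x < 0 -> H x = 0 &
      forall v, 0 < v ->
      (\int[mu]_(r in `[0%R, +oo[) (half_normal_pdf r * H (v * r))%:E = (beta 0 v)%:E)%E].
Proof.
have [s [H [ns H_homo H01 H_rc [limsup liminf]]]] := helly F_homo F01.
exists H; split => //.
  (* For x < 0 the lower bound on [F (s n)] is used at the point 0, where [F (s n)] vanishes. *)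
  move=> x x0; apply/eqP; rewrite eq_le; case/andP: (H01 x) => -> _; rewrite andbT.
  apply/ler_addgt0Pr => e e0; rewrite add0r.
  have [n _ /(_ n (leqnn n))] := liminf x 0 e x0 e0.
  by rewrite /F mul0r beta_neg// lerBlDr add0r.
have soo : s n @[n --> \oo] --> \oo.
  move=> A [N _ NA]; exists N => // n /= Nn; apply: NA => /=.
  exact: leq_trans Nn (ns n).
have Pcvg r : D r -> P (s n) r @[n --> \oo] --> half_normal_pdf r.
  move=> /D0 /ltW r0; apply: (cvg_comp s (fun n => P n r) soo).
  exact: cvg_rescaled_kernel.
have mH v : 0 < v -> measurable_fun [set: R] (fun r => H (v * r)).
  by move=> v0; exact: homo_measurable.
have mF n v : 0 < v -> measurable_fun [set: R] (fun r => F n (v * r)).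
  by move=> v0; apply: homo_measurable => //; exact: F_homo.
have mmin n v v' : 0 < v -> 0 < v' ->
    measurable_fun [set: R] (fun r => Num.min (F n (v' * r)) (H (v * r))).
  by move=> v0 v'0; exact: (measurable_minr (mF n v' v'0) (mH v v0)).
have mmax n v : 0 < v ->
    measurable_fun [set: R] (fun r => Num.max (F n (v * r)) (H (v * r))).
  by move=> v0; exact: (measurable_maxr (mF n v v0) (mH v v0)).
have pdf0 r : D r -> 0 <= half_normal_pdf r by move=> _; exact: half_normal_pdf_ge0.
(* [H] bounds the limits of [F (s n)] only up to a shift of the argument; the
   truncations by [H (v * r)] converge to [H (v * r)], and the shift from [v] to
   [v'] is removed at the end by continuity of [beta 0]. *)
have upper v v' : 0 < v -> v < v' ->
    (\int[mu]_(r in D) (half_normal_pdf r * H (v * r))%:E <= (beta 0 v')%:E)%E.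
  move=> v0 vv'; have v'0 := lt_trans v0 vv'.
  apply: (@fatou_cvg _ _ _ mu D
    (fun n r => P (s n) r * Num.min (F (s n) (v' * r)) (H (v * r)))) => //.
  - move=> n; apply: measurable_funTS; apply: measurable_funM; first exact: mP.
    exact: mmin.
  - move=> n r Dr; rewrite mulr_ge0 ?P_ge0// le_min.
    by case/andP: (F01 (s n) (v' * r)) => -> _; case/andP: (H01 (v * r)).
  - move=> r Dr; apply: cvgM; first exact: Pcvg.
    apply/cvgrPdist_le => e e0; have r0 := D0 Dr.
    have vr : v * r < v' * r by rewrite ltr_pM2r.
    apply: filterS (liminf _ _ e vr e0) => n hn.
    rewrite ger0_norm ?subr_ge0 ?ge_min ?lexx ?orbT//.
    by rewrite lerBlDr -lerBlDl le_min; apply/andP; split; lra.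
  - move=> n; rewrite -(kernel_eq (s n) v'0); apply: ge0_le_integral => //.
    + move=> r Dr; rewrite lee_fin mulr_ge0 ?P_ge0// le_min.
      by case/andP: (F01 (s n) (v' * r)) => -> _; case/andP: (H01 (v * r)).
    + apply/measurable_funTS/measurable_EFinP; apply: measurable_funM; first exact: mP.
      exact: mmin.
    + apply/measurable_funTS/measurable_EFinP.
      by apply: measurable_funM; [exact: mP|exact: mF].
    + by move=> r Dr; rewrite lee_fin ler_wpM2l ?P_ge0// ge_min lexx.
have lower v : 0 < v ->
    ((beta 0 v)%:E <= \int[mu]_(r in D) (half_normal_pdf r * H (v * r))%:E)%E.
  move=> v0.
  have h1 := compl_integral measurable_half_normal_pdf (mH v v0) pdf0
    (fun r => H01 (v * r)) pdf_mass.
  have h2 : (\int[mu]_(r in D) (half_normal_pdf r * (1 - H (v * r)))%:E <=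
      1 - (beta 0 v)%:E)%E.
    apply: (@fatou_cvg _ _ _ mu D
      (fun n r => P (s n) r * (1 - Num.max (F (s n) (v * r)) (H (v * r))))) => //.
    - move=> n; apply: measurable_funTS; apply: measurable_funM; first exact: mP.
      apply: measurable_funB => //; exact: mmax.
    - move=> n r Dr; rewrite mulr_ge0 ?P_ge0// subr_ge0 ge_max.
      by case/andP: (F01 (s n) (v * r)) => _ ->; case/andP: (H01 (v * r)).
    - move=> r Dr; apply: cvgM; first exact: Pcvg.
      apply: cvgB; first exact: cvg_cst.
      apply/cvgrPdist_le => e e0.
      apply: filterS (limsup (v * r) e e0) => n hn.
      rewrite distrC ger0_norm ?subr_ge0 ?le_max ?lexx ?orbT//.
      by rewrite lerBlDl ge_max; apply/andP; split; lra.
    - move=> n.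
      have := compl_integral (mP (s n)) (mF (s n) v v0) (@P_ge0 (s n))
        (fun r => F01 (s n) (v * r)) (kernel_mass (s n)).
      rewrite kernel_eq// => h.
      rewrite -h addeK//; apply: ge0_le_integral => //.
      + move=> r Dr; rewrite lee_fin mulr_ge0 ?P_ge0// subr_ge0 ge_max.
        by case/andP: (F01 (s n) (v * r)) => _ ->; case/andP: (H01 (v * r)).
      + apply/measurable_funTS/measurable_EFinP; apply: measurable_funM; first exact: mP.
        apply: measurable_funB => //.
        exact: mmax.
      + apply/measurable_funTS/measurable_EFinP; apply: measurable_funM; first exact: mP.
        by apply: measurable_funB => //; exact: mF.
      + by move=> r Dr; rewrite lee_fin ler_wpM2l ?P_ge0// lerB// le_max lexx.
  move: h2; rewrite leeBrDr// => h2.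
  (* Finiteness allows the complementary integral to be cancelled. *)
  have fin : (\int[mu]_(r in D) (half_normal_pdf r * (1 - H (v * r)))%:E)%E \is a fin_num.
    rewrite ge0_fin_numE; last first.
      apply: integral_ge0 => r /pdf0 pr; rewrite lee_fin mulr_ge0// subr_ge0.
      by case/andP: (H01 (v * r)).
    apply: (@le_lt_trans _ _ (1 - (beta 0 v)%:E)%E); first by rewrite leeBrDr.
    by rewrite -EFinB ltry.
  by move: h2; rewrite -h1 leeD2lE.
move=> v v0; rewrite -integralD; last first.
  by apply: measurable_funM; [exact: measurable_half_normal_pdf|exact: mH].
apply/eqP; rewrite eq_le lower// andbT.
apply/lee_addgt0Pr => e e0; rewrite -EFinD.
have /cvgrPdist_lt /(_ e e0) [a /= a0 Ha] := is_derive_continuous (dbeta 0 v0).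
have vv : v < v + a / 2 by rewrite ltrDl divr_gt0.
apply: (le_trans (upper v _ v0 vv)); rewrite lee_fin.
have := Ha (v + a / 2); rewrite /= opprD addrA subrr sub0r normrN gtr0_norm ?divr_gt0//.
rewrite ltr_pdivrMr// ltr_pMr// ltr1n => /(_ isT).
by rewrite ltr_norml => /andP[h _]; lra.
Qed.

End half_normal_representation.

(** * The mixing measure *)

Section probability_of_cdf.
Context {R : realType}.
Notation mu := (@lebesgue_measure R).

Let idR : measurableTypeR R -> R := idfun.

#[local] HB.instance Definition _ :=
  @isMeasurableFun.Build _ _ _ _ idR (@measurable_id _ _ setT).

Lemma probability_of_cdf (H : R -> R) : {homo H : x y / x <= y} ->
  right_continuous H -> H x @[x --> -oo] --> (0 : R) ->
  H x @[x --> +oo] --> (1 : R) ->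
  exists nu : probability (measurableTypeR R) R,
    forall x, nu `]-oo, x]%classic = (H x)%:E.
Proof.
move=> Hhomo Hrc H0 H1.
pose mC := isCumulative.Build R _ R H Hhomo Hrc.
pose mB := isCumulativeBounded.Build R 0 1 H H0 H1.
pose H' : cumulativeBounded 0 1 := HB.pack H mC mB.
exists (lebesgue_stieltjes_measure H') => x.
exact: (cdf_lebesgue_stieltjes_id H' x).
Qed.

(** Tonelli's theorem for p(r) on the region 0 < s, s u <= r: integrating in r first gives the tail
    at s u, in s first the mass of ]0, r/u], which is H(r/u) because H(0) = 0. *)
Lemma mixture_cdf (nu : probability (measurableTypeR R) R) (H : R -> R) :
  (forall x, nu `]-oo, x]%classic = (H x)%:E) -> H 0 = 0 ->
  forall u : R, 0 < u ->
  ((mixture nu u)%:E =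
    \int[mu]_(r in `[0%R, +oo[) (half_normal_pdf r * H (u^-1 * r))%:E)%E.
Proof.
move=> nuH H0 u u0.
pose f (z : measurableTypeR R * measurableTypeR R) : R :=
  if (0 < z.1) && (z.1 * u <= z.2) then half_normal_pdf z.2 else 0.
have f0 z : (0 <= (f z)%:E)%E.
  by rewrite lee_fin /f; case: ifP => // _; exact: half_normal_pdf_ge0.
have mf : measurable_fun [set: measurableTypeR R * measurableTypeR R] (EFin \o f).
  apply/measurable_EFinP; apply: measurable_fun_ifT => //.
  - apply: measurable_and; first exact: measurable_fun_ltr.
    by apply: measurable_fun_ler => //; exact: measurable_funM.
  - exact: (measurableT_comp measurable_half_normal_pdf measurable_snd).
have nu0 x : 0 <= x -> nu `]0, x]%classic = (H x)%:E.
  move=> x0; rewrite -nuH (_ : `]-oo, x]%classic = `]-oo, 0] `|` `]0, x]).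
    rewrite measureU//; last first.
      apply/seteqP; split=> // z [] /=; rewrite !in_itv/= => z0 /andP[+ _].
      by rewrite ltNge z0.
    transitivity (0 + nu `]0%R, x]%classic)%E; first by rewrite add0e.
    by congr (_ + _)%E; have := nuH 0; rewrite H0.
  apply/seteqP; split=> z /=; rewrite !in_itv/=.
    by move=> zx; have [z0|z0] := leP z 0; [left|right].
  by case=> [z0|/andP[_ //]]; exact: le_trans z0 x0.
have := @fubini_tonelli _ _ _ _ _ nu mu _ mf f0.
have -> : (\int[nu]_s \int[mu]_r (EFin \o f) (s, r) = (mixture nu u)%:E)%E.
  rewrite /mixture /Rintegral fineK; last first.
    exact: integrable_fin_num (mixture_integrable nu u).
  rewrite [RHS]integral_mkcond; apply: eq_integral => s _.
  rewrite /patch mem_setE in_itv/= andbT; case: ltP => s0; last first.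
    by rewrite integral0_eq// => r _; rewrite /f /= ltNge s0.
  rewrite half_normal_tailE [RHS]integral_mkcond; apply: eq_integral => r _.
  by rewrite /patch mem_setE in_itv/= andbT /f /= s0 /=; case: ifP.
move=> ->; rewrite [RHS]integral_mkcond; apply: eq_integral => r _.
rewrite /patch mem_setE in_itv/= andbT; case: leP => r0; last first.
  rewrite integral0_eq// => s _; rewrite /f /=; case: ifP => // /andP[s0 sr].
  by have := lt_le_trans (mulr_gt0 s0 u0) sr; rewrite ltNge (ltW r0).
have ru : 0 <= u^-1 * r by rewrite mulr_ge0// invr_ge0 ltW.
rewrite EFinM -(nu0 _ ru) -integral_cst//.
rewrite [RHS]integral_mkcond; apply: eq_integral => s _.
rewrite /patch mem_setE in_itv/= /f /=.
have -> : (s <= u^-1 * r) = (s * u <= r) by rewrite [u^-1 * r]mulrC ler_pdivlMr.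
by case: ifP.
Qed.

End probability_of_cdf.

(** * Existence of the mixing measure *)

Section bernstein.
Context {R : realType}.
Notation mu := (@lebesgue_measure R).

Let integral_pdf_cst (c : R) : 0 <= c ->
  (\int[mu]_(r in `[0%R, +oo[) (half_normal_pdf r * c)%:E = c%:E)%E.
Proof.
move=> c0; under eq_integral do rewrite EFinM.
rewrite ge0_integralZr//=.
- by rewrite half_normal_pdf_integral mul1e.
- by apply/measurable_funTS/measurable_EFinP; exact: measurable_half_normal_pdf.
- by move=> r _; rewrite lee_fin half_normal_pdf_ge0.
Qed.

Let le_integral_pdf (f g : R -> R) : measurable_fun [set: R] f ->
  measurable_fun [set: R] g -> (forall r, 0 <= r -> 0 <= f r <= g r) ->
  (\int[mu]_(r in `[0%R, +oo[) (half_normal_pdf r * f r)%:E <=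
   \int[mu]_(r in `[0%R, +oo[) (half_normal_pdf r * g r)%:E)%E.
Proof.
move=> mf mg fg; have mp := @measurable_half_normal_pdf R.
have D0 r : `[0, +oo[%classic r -> 0 <= r by rewrite /= in_itv/= andbT.
apply: ge0_le_integral => //.
- move=> r /D0/fg/andP[fr _]; by rewrite lee_fin mulr_ge0 ?half_normal_pdf_ge0.
- by apply/measurable_funTS/measurable_EFinP; exact: measurable_funM.
- by apply/measurable_funTS/measurable_EFinP; exact: measurable_funM.
- move=> r /D0/fg/andP[_ fr].
  by rewrite lee_fin ler_wpM2l ?half_normal_pdf_ge0.
Qed.

Lemma mixture_of_completely_monotone (phi : R -> R) : admissible phi ->
  completely_monotone (neg_deriv_sqrt phi) ->
  exists2 nu : probability (measurableTypeR R) R, on_pos nu &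
    forall u, 0 <= u -> phi u = mixture nu u.
Proof.
move=> [cphi sphi phi0 phiy] [_ alt].
have d_ge0 k (v : R) : 0 < v -> 0 <= bern_deriv phi k v.
  move=> v0; have w0 : 0 < v^-1 ^+ 2 by rewrite exprn_gt0 ?invr_gt0.
  rewrite /bern_deriv -mulrA [X in _ * X]mulrA mulr_ge0 ?(ltW (bern_coef_gt0 _))//.
  by rewrite mulr_ge0 ?alt// exprn_ge0// invr_ge0 ltW.
have b0 : bern phi 0 v @[v --> 0^'+] --> (0 : R).
  apply/cvgrPdist_lt => e e0.
  move/cvgrPdist_lt : phiy => /(_ e e0) [M [_ HM]].
  near=> v; have v0 : 0 < v by near: v; exact: nbhs_right_gt.
  rewrite bern0E//; apply: HM.
  have M1 : 0 < `|M| + 1 by rewrite ltr_wpDl.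
  apply: (@lt_le_trans _ _ (`|M| + 1)).
    by rewrite (le_lt_trans (ler_norm M))// ltrDl.
  rewrite -[leLHS]invrK lef_pV2 ?posrE ?invr_gt0//; near: v.
  by apply: nbhs_right_le; rewrite invr_gt0.
have b1 : bern phi 0 v @[v --> +oo] --> (1 : R).
  move/continuous_within_itvcyP : cphi => [_ phi0r].
  apply/cvgrPdist_lt => e e0.
  move/cvgrPdist_lt : phi0r => /(_ e e0) [a /= a0 Ha].
  near=> v; have v0 : 0 < v by near: v; apply: nbhs_pinfty_gt; rewrite num_real.
  rewrite (lt_geF v0) -phi0; apply: Ha; last by rewrite /= invr_gt0.
  rewrite /= sub0r normrN gtr0_norm ?invr_gt0//.
  rewrite -[ltRHS]invrK ltf_pV2 ?posrE ?invr_gt0//; near: v.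
  by apply: nbhs_pinfty_gt; rewrite num_real.
have [H [H_homo H01 H_rc Hneg rep]] := half_normal_representation
  (@is_derive_bern R phi sphi) d_ge0 (@bernS R phi) (@bern_neg R phi) b0 b1.
have mH v : 0 < v -> measurable_fun [set: R] (fun r => H (v * r)).
  move=> v0; apply: nondecreasing_measurable => // x y xy.
  by apply: H_homo; rewrite ler_wpM2l// ltW.
(* Since H(vr) >= H(0) and p has mass 1, H(0) <= beta_0(v), which tends to 0 with v. *)
have H0 : H 0 = 0.
  apply/eqP; rewrite eq_le; case/andP: (H01 0) => Hge0 _; rewrite Hge0 andbT.
  apply/ler_addgt0Pr => e e0; rewrite add0r.
  move/cvgrPdist_lt : b0 => /(_ e e0) [a /= a0 Ha].
  have a20 : 0 < a / 2 by rewrite divr_gt0.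
  apply: (@le_trans _ _ (bern phi 0 (a / 2))).
    rewrite -lee_fin -rep// -(integral_pdf_cst Hge0); apply: le_integral_pdf => //.
      exact: mH.
    by move=> r r0; rewrite Hge0 H_homo// mulr_ge0// ltW.
  have := Ha (a / 2); rewrite /= !sub0r !normrN gtr0_norm// => h.
  apply: le_trans (ler_norm _) (ltW (h _ a20)).
  by rewrite ltr_pdivrMr// ltr_pMr// ltr1n.
(* If H stayed below 1 - e, so would beta_0, against its limit 1. *)
have H1 : H x @[x --> +oo] --> (1 : R).
  apply/cvgrPdist_le => e e0.
  have [x0 Hx0] : exists x0, 1 - e < H x0.
    apply: contrapT => /forallNP nH.
    have He x : H x <= 1 - e by rewrite leNgt; apply/negP/nH.
    move/cvgrPdist_lt : b1 => /(_ e e0) [M [_ HM]].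
    pose v := Num.max 1 (M + 1).
    have v0 : 0 < v by rewrite lt_max ltr01.
    have Mv : M < v by rewrite lt_max ltrDl ltr01 orbT.
    have e1 : 0 <= 1 - e by apply: le_trans (He 0); case/andP: (H01 0).
    have : bern phi 0 v <= 1 - e.
      rewrite -lee_fin -rep// -(integral_pdf_cst e1); apply: le_integral_pdf => //.
        exact: mH.
      by move=> r _; rewrite He andbT; case/andP: (H01 (v * r)).
    have := HM v Mv; rewrite ltr_norml => /andP[_ h]; lra.
  near=> x; have x0x : x0 <= x by near: x; apply: nbhs_pinfty_ge; rewrite num_real.
  have /andP[_ Hx1] := H01 x; have h := H_homo _ _ x0x.
  by rewrite ger0_norm ?subr_ge0//; lra.
have HN : H x @[x --> -oo] --> (0 : R).
  apply/cvgrPdist_le => e e0; near=> x.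
  have x0 : x < 0 by near: x; apply: nbhs_ninfty_lt; rewrite num_real.
  by rewrite Hneg// subrr normr0 ltW.
have [nu nuH] := probability_of_cdf H_homo H_rc HN H1.
have nu_pos : on_pos nu.
  rewrite /on_pos -[`]0, +oo[%classic]setCitvl probability_setC//.
  by have := nuH 0; rewrite H0 => ->; rewrite sube0.
exists nu => // u; rewrite le_eqVlt => /predU1P[<-|u0]; first by rewrite mixture0.
apply: EFin_inj; rewrite (mixture_cdf nuH H0 u0) rep ?invr_gt0//.
by rewrite bern0E ?invr_gt0// invrK.
Unshelve. all: by end_near. Qed.

End bernstein.

(** * Equality of the two classes *)

Theorem corollary4p3 (R : realType) (d : nat) (gamma : 'rV[R]_d -> R)
    (hgamma : variogram gamma) :
  [set f : 'rV[R]_d -> R |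
     exists nu : probability (measurableTypeR R) R,
       on_pos nu /\ f = rho gamma nu] =
  [set f : 'rV[R]_d -> R |
     exists phi : R -> R,
       [/\ admissible phi,
           inf_often_alternating (neg_deriv_sqrt phi)
         & f = (fun h => phi (Num.sqrt (gamma h)))]]
  /\
  (forall phi : R -> R, admissible phi ->
     (inf_often_alternating (neg_deriv_sqrt phi) <->
      completely_monotone (neg_deriv_sqrt phi))).
Proof.
split; last exact: inf_often_alternatingP.
apply/seteqP; split=> [f [nu [nu_pos ->]]|f [phi [aphi inf ->]]].
  have adm := admissible_mixture nu_pos.
  (* [rho gamma nu h] unfolds to [mixture nu (Num.sqrt (gamma h))]. *)
  exists (mixture nu); split => //; apply/inf_often_alternatingP => //.
  split; first by apply: smooth_neg_deriv_sqrt; case: adm.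
  exact: alternating_mixture.
have [nu nu_pos phiE] := mixture_of_completely_monotone aphi
  ((inf_often_alternatingP aphi).1 inf).
by exists nu; split => //; apply/funext => h; rewrite phiE ?sqrtr_ge0.
Qed.
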